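(* Let $(X,\mathscr A,\mu)$ be a $\sigma$-finite measure space, let $\phi\colon X\to X$ and $w\colon X\to\mathbb C$ be $\mathscr A$-measurable, and assume that $C_{\phi,w}$ and $C_\phi$ are densely defined in $L^2(\mu)$. Consider the following conditions: (a$_1$) $C_{\phi,w}^\dag=C_\phi^\dag M_w^\dag$, (a$_2$) $C_{\phi,w}^\dag\subseteq C_\phi^\dag M_w^\dag$, (a$_3$) $C_{\phi,w}^\dag\supseteq C_\phi^\dag M_w^\dag$, (b$_1$) for every $f\in\mathcal D(C_{\phi,w}^\dag)$, $f_w\in L^2(\mu)$ and $\mathsf E_{\phi,w}(f_w)\circ\phi^{-1}=\mathsf E_\phi(f_w)\circ\phi^{-1}$ a.e. $[\mu]$, (b$_2$) for every $f\in L^2((1+|w|^{-2})\,d\mu)$, $\mathsf E_{\phi,w}(f_w)\circ\phi^{-1}=\mathsf E_\phi(f_w)\circ\phi^{-1}$ a.e. $[\mu]$, (c) $|w|^2=\mathsf E_\phi(|w|^2)$ a.e. $[\mu]$ on $\{w\neq0\}$. Then (a$_1$) $\Leftrightarrow$ (a$_2$) $\Leftrightarrow$ (b$_1$) $\Rightarrow$ (c) $\Rightarrow$ (b$_2$) $\Rightarrow$ (a$_3$).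
   Context: Notation: $\mathcal D(T)$, $\mathcal N(T)$, $\mathcal R(T)$ are the domain, kernel and range of an operator $T$; $S\subseteq T$ means that the operator $T$ extends $S$; products of operators have their natural (maximal) domains. $L^2(\mu)$ is the complex Hilbert space of square $\mu$-integrable $\mathscr A$-measurable complex functions on $X$. Conventions: $\frac10=\infty$, $0\cdot\infty=0$. Weighted composition operators. Put $\mu_w(\sigma)=\int_\sigma|w|^2\,d\mu$ and $\mu_w\circ\phi^{-1}(\sigma)=\mu_w(\phi^{-1}(\sigma))$ for $\sigma\in\mathscr A$. If $\mu_w\circ\phi^{-1}$ is absolutely continuous with respect to $\mu$, then $C_{\phi,w}$ is said to be well-defined and is the operator in $L^2(\mu)$ with $\mathcal D(C_{\phi,w})=\{f\in L^2(\mu)\colon w\cdot(f\circ\phi)\in L^2(\mu)\}$, $C_{\phi,w}f=w\cdot(f\circ\phi)$ (it is closed). ''Densely defined'' includes being well-defined. $\mathsf h_{\phi,w}\colon X\to[0,\infty]$ is the Radon–Nikodym derivative: $\mu_w\circ\phi^{-1}(\Delta)=\int_\Delta\mathsf h_{\phi,w}\,d\mu$ for $\Delta\in\mathscr A$. $M_w$ is the multiplication operator: $\mathcal D(M_w)=\{f\in L^2(\mu)\colon wf\in L^2(\mu)\}$, $M_wf=wf$. Conditional expectation. If $C_{\phi,w}$ is densely defined, then for an $\mathscr A$-measurable $f\colon X\to[0,\infty]$, or $f\in L^p(\mu_w)$ with $1\le p<\infty$, $\mathsf E_{\phi,w}(f)$ denotes the conditional expectation of $f$ with respect to the $\sigma$-algebra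 $\phi^{-1}(\mathscr A)$ and the measure $\mu_w$. The expression $\mathsf E_{\phi,w}(f)\circ\phi^{-1}$ denotes the unique (up to $\mu$-null sets) $\mathscr A$-measurable function $g$ on $X$ such that $g=0$ a.e. $[\mu]$ on $\{\mathsf h_{\phi,w}=0\}$ and $\mathsf E_{\phi,w}(f)=g\circ\phi$ a.e. $[\mu_w]$. For the constant weight $\mathbf 1$ write $C_\phi:=C_{\phi,\mathbf 1}$, $\mathsf h_\phi:=\mathsf h_{\phi,\mathbf 1}$, $\mathsf E_\phi:=\mathsf E_{\phi,\mathbf 1}$ (here $\mu_{\mathbf 1}=\mu$). For $f\in L^2(\mu)$, $f_w:=\chi_{\{w\neq0\}}\frac fw$ (so $f_w\in L^2(\mu_w)$). Reciprocal. Let $T$ be a linear operator in a Hilbert space $\mathcal H$ with $\mathcal D(T)=\mathcal N(T)\oplus(\mathcal D(T)\cap\mathcal N(T)^\perp)$ (this holds for closed $T$). The reciprocal $T^\dag$ is the unique densely defined operator with domain $\mathcal D(T^\dag)=\mathcal R(T)\oplus\mathcal R(T)^\perp$ such that $TT^\dag f=P_{\overline{\mathcal R(T)}}f$ for $f\in\mathcal D(T^\dag)$, $T^\dag Tg=P_{\mathcal N(T)^\perp}g$ for $g\in\mathcal D(T)$, and $\mathcal N(T^\dag)=\mathcal R(T)^\perp$, where $P_M$ is the orthogonal projection onto the closed subspace $M$. *)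

(* Defs.v *)
From HB Require Import structures.
From mathcomp Require Import all_boot all_order all_algebra.
From mathcomp Require Import all_classical all_reals all_analysis.
From mathcomp Require Import measurable_realfun complex ring lra.

Set Implicit Arguments.
Unset Strict Implicit.
Unset Printing Implicit Defensive.
Import Order.TTheory GRing.Theory Num.Theory.
Import numFieldNormedType.Exports.
Local Open Scope classical_set_scope.
Local Open Scope ring_scope.
Local Open Scope complex_scope.

Local Notation Re := (@complex.Re _).
Local Notation Im := (@complex.Im _).

(* In this file [nu] is a plain set function: integrals, [.-integrable] and
   [{ae nu, _}] only need this, so weighted measures such as [mu_w] below can
   be used without carrying a proof that their density is measurable. *)
Section complex_functions.
Context {d} {X : measurableType d} {R : realType}.
Implicit Types (nu : set X -> \bar R) (f g : X -> R[i]).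

(* |z|^2 as an element of [R] (the norm of [R[i]] takes values in [R[i]]) *)
Definition normc2 (z : R[i]) : R := Re z ^+ 2 + Im z ^+ 2.

Definition cmeasurable f :=
  measurable_fun setT (Re \o f) /\ measurable_fun setT (Im \o f).

Definition cintegrable nu (D : set X) f :=
  nu.-integrable D (fun x => (Re (f x))%:E) /\
  nu.-integrable D (fun x => (Im (f x))%:E).

Definition cintegral nu (D : set X) f : R[i] :=
  fine (\int[nu]_(x in D) (Re (f x))%:E) +i*
  fine (\int[nu]_(x in D) (Im (f x))%:E).

(* Elements of L^2(nu) are represented by functions; equality in L^2(nu) is
   [ae_eq2 nu]. *)
Definition L2 nu : set (X -> R[i]) :=
  [set f | cmeasurable f /\ (\int[nu]_x (normc2 (f x))%:E < +oo)%E].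

Definition ae_eq2 nu f g := {ae nu, forall x, f x = g x}.

Definition inner nu f g : R[i] := cintegral nu setT (fun x => f x * (g x)^*%C).

Definition L2norm nu f : R :=
  Num.sqrt (fine (\int[nu]_x (normc2 (f x))%:E)).

Definition L2closure nu (A : set (X -> R[i])) : set (X -> R[i]) :=
  [set f | L2 nu f /\
     forall eps : R, 0 < eps -> exists2 g, A g & L2norm nu (f \- g) < eps].

Definition dense_in_L2 nu (A : set (X -> R[i])) := L2 nu `<=` L2closure nu A.

Definition orth nu (A : set (X -> R[i])) : set (X -> R[i]) :=
  [set f | L2 nu f /\ forall g, A g -> inner nu f g = 0].

(* [p] represents the orthogonal projection of [f] onto the closed subspace
   [M] *)
Definition is_proj nu (M : set (X -> R[i])) f p := M p /\ orth nu M (f \- p).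

Definition sum_set (A B : set (X -> R[i])) : set (X -> R[i]) :=
  [set f | exists a b, [/\ A a, B b & f = a \+ b]].

End complex_functions.

(* An operator is its graph. A graph is closed under [ae_eq2], so equality and
   inclusion of graphs as sets are equality and extension of operators. *)
Section operators.
Context {d} {X : measurableType d} {R : realType}.
Implicit Types (nu : set X -> \bar R).

Definition operator := set ((X -> R[i]) * (X -> R[i])).

Implicit Types (S T : operator).

Definition dom T : set (X -> R[i]) := [set f | exists g, T (f, g)].
Definition ran T : set (X -> R[i]) := [set g | exists f, T (f, g)].
Definition ker T : set (X -> R[i]) := [set f | T (f, cst 0)].

Definition opcomp S T : operator :=
  [set fh | exists2 g, T (fh.1, g) & S (g, fh.2)].

Record is_operator nu T : Prop := {
  op_L2 : forall f g, T (f, g) -> L2 nu f /\ L2 nu g ;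
  op_ae : forall f g f' g', T (f, g) -> L2 nu f' -> L2 nu g' ->
    ae_eq2 nu f f' -> ae_eq2 nu g g' -> T (f', g') ;
  op_fun : forall f g g', T (f, g) -> T (f, g') -> ae_eq2 nu g g' ;
  op_0 : T (cst 0, cst 0) ;
  op_lin : forall (a : R[i]) f g f' g', T (f, g) -> T (f', g') ->
    T ((fun x => a * f x + f' x), (fun x => a * g x + g' x)) }.

(* There is no clause saying that [dom S] is dense: the sum of a subspace and
   its orthogonal complement always is. *)
Record is_reciprocal nu T S : Prop := {
  recip_op : is_operator nu S ;
  recip_dom : dom S = sum_set (ran T) (orth nu (ran T)) ;
  recip_l : forall f, dom S f ->
    exists2 p, opcomp T S (f, p) & is_proj nu (L2closure nu (ran T)) f p ;
  recip_r : forall g, dom T g ->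
    exists2 p, opcomp S T (g, p) & is_proj nu (orth nu (ker T)) g p ;
  recip_ker : ker S = orth nu (ran T) }.

(* The reciprocal of [T], unique by [is_reciprocal_uniq]; it exists as soon as
   D(T) = N(T) + (D(T) `&` N(T)^perp), see [reciprocalP]. *)
Definition reciprocal nu T : operator := xget set0 (is_reciprocal nu T).

End operators.
Arguments operator {d} X R.


Section L2_theory.
Context {d} {X : measurableType d} {R : realType}.
Variable mu : {measure set X -> \bar R}.
Implicit Types (f g : X -> R[i]).

Lemma normc2_ge0 (z : R[i]) : 0 <= normc2 z.
Proof. by rewrite /normc2 addr_ge0// sqr_ge0. Qed.

Lemma normc2_eq0 (z : R[i]) : normc2 z = 0 -> z = 0.
Proof.
case: z => a b; rewrite /normc2/= => /eqP.
rewrite paddr_eq0 ?sqr_ge0// !sqrf_eq0 => /andP[/eqP -> /eqP ->] //.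
Qed.

Lemma measurable_normc2 f : cmeasurable f ->
  measurable_fun setT (fun x => normc2 (f x)).
Proof. by move=> [mr mi]; apply: measurable_funD; exact: measurable_funX. Qed.

Lemma cmeasurable_lin (a : R[i]) f g : cmeasurable f -> cmeasurable g ->
  cmeasurable (fun x => a * f x + g x).
Proof.
case: a => a b [mf1 mf2] [mg1 mg2]; split.
  rewrite (_ : _ \o _ =
     ((a \*o (Re \o f)) \- (b \*o (Im \o f))) \+ (Re \o g)); last first.
    by apply/funext => x /=; case: (f x) => ? ?; case: (g x).
  apply: measurable_funD => //; apply: measurable_funB; exact: measurable_funM.
rewrite (_ : _ \o _ =
     ((a \*o (Im \o f)) \+ (b \*o (Re \o f))) \+ (Im \o g)); last first.
  by apply/funext => x /=; case: (f x) => ? ?; case: (g x).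
apply: measurable_funD => //; apply: measurable_funD; exact: measurable_funM.
Qed.

Lemma L2_integrable f : L2 mu f ->
  mu.-integrable setT (fun x => (normc2 (f x))%:E).
Proof.
move=> [mf fi]; apply/integrableP; split.
  by apply/measurable_EFinP; exact: measurable_normc2.
by under eq_integral do rewrite gee0_abs ?lee_fin ?normc2_ge0//.
Qed.

Lemma L2_bound f (h : X -> R) : cmeasurable f -> mu.-integrable setT (EFin \o h) ->
  (forall x, normc2 (f x) <= h x) -> L2 mu f.
Proof.
move=> mf hi fh; split=> //.
have : mu.-integrable setT (fun x => (normc2 (f x))%:E).
  apply: (le_integrable measurableT _ _ hi).
    by apply/measurable_EFinP; exact: measurable_normc2.
  move=> x _ /=; rewrite lee_fin ger0_norm ?normc2_ge0//.
  exact: le_trans (fh x) (ler_norm _).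
move=> /integrableP[_]; apply: le_lt_trans.
by under [leRHS]eq_integral do rewrite gee0_abs ?lee_fin ?normc2_ge0//.
Qed.

Lemma L2_lin (a : R[i]) f g : L2 mu f -> L2 mu g ->
  L2 mu (fun x => a * f x + g x).
Proof.
move=> Lf Lg.
apply: (@L2_bound _ (fun x => 2 * normc2 a * normc2 (f x) + 2 * normc2 (g x))).
- by apply: cmeasurable_lin; [case: Lf|case: Lg].
- under [X in _.-integrable _ X]eq_fun do rewrite /= EFinD !EFinM -EFinM.
  by apply: integrableD => //; apply: integrableZl => //; exact: L2_integrable.
- move=> x; rewrite /normc2.
  case: a (f x) (g x) => a b [u v] [s t] /=.
  rewrite -subr_ge0.
  rewrite (_ : _ - _ = (a * u - b * v - s) ^+ 2 + (a * v + b * u - t) ^+ 2).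
    by rewrite addr_ge0 ?sqr_ge0.
  ring.
Qed.

Lemma L2_0 : L2 mu (cst 0).
Proof.
split.
  by split; rewrite (_ : _ \o _ = cst 0)//; exact: measurable_cst.
rewrite (_ : (fun _ => _) = cst 0%E) ?integral0//.
by apply/funext => x; rewrite /normc2/= expr0n/= addr0.
Qed.

Lemma L2_sub f g : L2 mu f -> L2 mu g -> L2 mu (f \- g).
Proof.
move=> Lf Lg; rewrite (_ : _ \- _ = (fun x => (-1) * g x + f x)); last first.
  by apply/funext => x /=; rewrite mulN1r addrC.
exact: L2_lin.
Qed.

Let amgm (p q r s : R) : `|p * r + q * s| <= p ^+ 2 + q ^+ 2 + (r ^+ 2 + s ^+ 2).
Proof.
have h1 := sqr_ge0 (p + r); have h2 := sqr_ge0 (q + s).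
have h3 := sqr_ge0 (p - r); have h4 := sqr_ge0 (q - s).
have h5 := sqr_ge0 p; have h6 := sqr_ge0 q.
have h7 := sqr_ge0 r; have h8 := sqr_ge0 s.
by rewrite ler_norml; apply/andP; split; lra.
Qed.

Let Re_prod_le (y z : R[i]) : `|Re (y * z^*%C)| <= normc2 y + normc2 z.
Proof.
case: y z => u v [s t]; rewrite /normc2 /= mulrN opprK.
exact: amgm.
Qed.

Let Im_prod_le (y z : R[i]) : `|Im (y * z^*%C)| <= normc2 y + normc2 z.
Proof.
case: y z => u v [s t]; rewrite /normc2 /=.
rewrite (_ : _ + _ * _ = v * s + u * (- t)); last by ring.
apply: (le_trans (amgm _ _ _ _)).
by rewrite sqrrN (addrC (v ^+ 2)).
Qed.

Lemma cintegrable_prod f g : L2 mu f -> L2 mu g ->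
  cintegrable mu setT (fun x => f x * (g x)^*%C).
Proof.
move=> Lf Lg.
have bi : mu.-integrable setT (fun x => (normc2 (f x) + normc2 (g x))%:E).
  by under [X in _.-integrable _ X]eq_fun do rewrite EFinD;
    apply: integrableD => //; exact: L2_integrable.
have [[mf1 mf2] _] := Lf; have [[mg1 mg2] _] := Lg.
split; apply: (le_integrable measurableT _ _ bi).
- apply/measurable_EFinP.
  rewrite (_ : (fun _ => _) = ((Re \o f) \* (Re \o g)) \+ ((Im \o f) \* (Im \o g))).
    by apply: measurable_funD; exact: measurable_funM.
  by apply/funext => x /=; case: (f x) (g x) => ? ? [? ?] /=; ring.
- move=> x _; rewrite !abse_EFin lee_fin.
  rewrite [leRHS]ger0_norm ?(addr_ge0 (normc2_ge0 _) (normc2_ge0 _))//.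
- apply/measurable_EFinP.
  rewrite (_ : (fun _ => _) = ((Im \o f) \* (Re \o g)) \- ((Re \o f) \* (Im \o g))).
    by apply: measurable_funB; exact: measurable_funM.
  by apply/funext => x /=; case: (f x) (g x) => ? ? [? ?] /=; ring.
- move=> x _; rewrite !abse_EFin lee_fin.
  rewrite [leRHS]ger0_norm ?(addr_ge0 (normc2_ge0 _) (normc2_ge0 _))//.
Qed.

Let fint (h : X -> R) := fine (\int[mu]_x (h x)%:E).

Let fint_lin (a b : R) (h k : X -> R) :
  mu.-integrable setT (EFin \o h) -> mu.-integrable setT (EFin \o k) ->
  fint (fun x => a * h x + b * k x) = a * fint h + b * fint k.
Proof.
move=> hi ki; rewrite /fint.
under eq_integral do rewrite EFinD 2!EFinM.
rewrite integralD//=; [|exact: integrableZl|exact: integrableZl].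
rewrite !integralZl//=.
have hf : (\int[mu]_x (h x)%:E)%E \is a fin_num by exact: integrable_fin_num.
have kf : (\int[mu]_x (k x)%:E)%E \is a fin_num by exact: integrable_fin_num.
by rewrite fineD ?fin_numM// !fineM.
Qed.

Lemma inner_lin (a : R[i]) f f' g : L2 mu f -> L2 mu f' -> L2 mu g ->
  inner mu (fun x => a * f x + f' x) g = a * inner mu f g + inner mu f' g.
Proof.
move=> Lf Lf' Lg.
have [r1 i1] := cintegrable_prod Lf Lg.
have [r2 i2] := cintegrable_prod Lf' Lg.
case: a => a b; rewrite /inner /cintegral /=.
set r1' := fun x => Re (f x * (g x)^*%C) in r1 *.
set i1' := fun x => Im (f x * (g x)^*%C) in i1 *.
set r2' := fun x => Re (f' x * (g x)^*%C) in r2 *.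
set i2' := fun x => Im (f' x * (g x)^*%C) in i2 *.
have ri : mu.-integrable setT (EFin \o (fun x => a * r1' x + - b * i1' x)).
  rewrite (_ : _ \o _ = (fun x => a%:E * (r1' x)%:E + (- b)%:E * (i1' x)%:E)%E);
    last by apply/funext => x; rewrite /= EFinD !EFinM.
  by apply: integrableD => //; exact: integrableZl.
have ii : mu.-integrable setT (EFin \o (fun x => a * i1' x + b * r1' x)).
  rewrite (_ : _ \o _ = (fun x => a%:E * (i1' x)%:E + b%:E * (r1' x)%:E)%E);
    last by apply/funext => x; rewrite /= EFinD !EFinM.
  by apply: integrableD => //; exact: integrableZl.
rewrite -!/(fint _).
rewrite (_ : (fun x => Re (((a +i* b) * f x + f' x) * (g x)^*%C)) =
   fun x => 1 * (a * r1' x + - b * i1' x) + 1 * r2' x); last first.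
  apply/funext => x; rewrite /r1' /i1' /r2'.
  by case: (f x) (f' x) (g x) => ? ? [? ?] [? ?] /=; ring.
rewrite (_ : (fun x => Im (((a +i* b) * f x + f' x) * (g x)^*%C)) =
   fun x => 1 * (a * i1' x + b * r1' x) + 1 * i2' x); last first.
  apply/funext => x; rewrite /r1' /i1' /i2'.
  by case: (f x) (f' x) (g x) => ? ? [? ?] [? ?] /=; ring.
rewrite !fint_lin//.
by apply/eqP; rewrite eq_complex /=; apply/andP; split; apply/eqP; ring.
Qed.

Let integrable_normc2 f : L2 mu f ->
  mu.-integrable setT (EFin \o (fun x => normc2 (f x))).
Proof. exact: L2_integrable. Qed.

Let fint_normr_le (h k : X -> R) :
  mu.-integrable setT (EFin \o h) -> mu.-integrable setT (EFin \o k) ->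
  (forall x, `|h x| <= k x) -> `|fint h| <= fint k.
Proof.
move=> hi ki hk.
have hf : (\int[mu]_x (h x)%:E)%E \is a fin_num by exact: integrable_fin_num.
have kf : (\int[mu]_x (k x)%:E)%E \is a fin_num by exact: integrable_fin_num.
rewrite -lee_fin /fint -abse_EFin !fineK//.
apply: (le_trans (le_abse_integral mu measurableT _)).
  by case/integrableP: hi.
apply: ge0_le_integral => //.
- by apply: measurableT_comp => //; case/integrableP: hi.
- by case/integrableP: ki.
- by move=> x _; rewrite /= lee_fin.
Qed.

Lemma inner_bound f g : L2 mu f -> L2 mu g ->
  let B := fine (\int[mu]_x (normc2 (f x))%:E) +
           fine (\int[mu]_x (normc2 (g x))%:E) in
  `|Re (inner mu f g)| <= B /\ `|Im (inner mu f g)| <= B.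
Proof.
move=> Lf Lg B.
have [ri ii] := cintegrable_prod Lf Lg.
have fi := integrable_normc2 Lf; have gi := integrable_normc2 Lg.
have -> : B = fint (fun x => 1 * normc2 (f x) + 1 * normc2 (g x)).
  by rewrite fint_lin// !mul1r.
have bi : mu.-integrable setT
    (EFin \o (fun x => 1 * normc2 (f x) + 1 * normc2 (g x))).
  rewrite (_ : _ \o _ = (fun x => (normc2 (f x))%:E + (normc2 (g x))%:E)%E);
    last by apply/funext => x; rewrite /= !mul1r EFinD.
  exact: integrableD.
by split; apply: fint_normr_le => // x; rewrite !mul1r.
Qed.

Lemma inner_ae f f' g : ae_eq2 mu f f' -> L2 mu f -> L2 mu f' -> L2 mu g ->
  inner mu f g = inner mu f' g.
Proof.
move=> ff' Lf Lf' Lg; rewrite /inner /cintegral.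
have [/integrableP[r1 _] /integrableP[i1 _]] := cintegrable_prod Lf Lg.
have [/integrableP[r2 _] /integrableP[i2 _]] := cintegrable_prod Lf' Lg.
congr (fine _ +i* fine _); apply: ae_eq_integral => //;
  by apply: filterS ff' => x -> .
Qed.

Lemma inner_conj f g : L2 mu f -> L2 mu g -> inner mu f g = (inner mu g f)^*%C.
Proof.
move=> Lf Lg; rewrite /inner /cintegral -!/(fint _).
have [r2 i2] := cintegrable_prod Lg Lf.
rewrite /=; congr (_ +i* _).
  congr fint; apply/funext => x.
  by case: (f x) (g x) => ? ? [? ?] /=; ring.
rewrite (_ : (fun x => Im (f x * (g x)^*%C)) =
    (fun x => (-1) * Im (g x * (f x)^*%C) + 0 * Im (g x * (f x)^*%C))).
  by rewrite fint_lin// mul0r addr0 mulN1r.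
by apply/funext => x; case: (f x) (g x) => ? ? [? ?] /=; ring.
Qed.

Lemma inner_eq0 f : L2 mu f -> inner mu f f = 0 -> ae_eq2 mu f (cst 0).
Proof.
move=> Lf; rewrite /inner /cintegral => -[+ _].
rewrite (_ : (fun x => (Re (f x * (f x)^*%C))%:E) =
             (fun x => (normc2 (f x))%:E)); last first.
  by apply/funext => x; rewrite /normc2; case: (f x) => ? ? /=; congr EFin; ring.
have fi := integrable_normc2 Lf.
have ff : (\int[mu]_x (normc2 (f x))%:E)%E \is a fin_num.
  exact: (integrable_fin_num _ fi).
move=> f0.
have /ae_eq_integral_abs : measurable_fun setT (fun x => (normc2 (f x))%:E).
  by case/integrableP: fi.
move=> /(_ mu measurableT)[+ _]; under eq_integral do
  rewrite gee0_abs ?lee_fin ?normc2_ge0//.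
rewrite -(fineK ff) f0 => /(_ erefl).
by apply: filterS => x /(_ I) /= xE; apply: normc2_eq0; apply: EFin_inj.
Qed.

Lemma inner0l g : L2 mu g -> inner mu (cst 0) g = 0.
Proof.
move=> Lg; have := inner_lin (-1) L2_0 L2_0 Lg.
rewrite mulN1r addNr; apply: etrans; congr (inner mu _ g).
by apply/funext => x /=; rewrite mulr0 addr0.
Qed.

Lemma orth_0 (A : set (X -> R[i])) : A `<=` L2 mu -> orth mu A (cst 0).
Proof. by move=> AL; split; [exact: L2_0|move=> g /AL /inner0l]. Qed.

Lemma orth_lin (a : R[i]) (A : set (X -> R[i])) f f' : A `<=` L2 mu ->
  orth mu A f -> orth mu A f' -> orth mu A (fun x => a * f x + f' x).
Proof.
move=> AL [Lf fA] [Lf' f'A]; split; first exact: L2_lin.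
by move=> g Ag; rewrite inner_lin ?fA ?f'A ?mulr0 ?addr0//; exact: AL.
Qed.

Lemma orth_ae (A : set (X -> R[i])) f f' : A `<=` L2 mu ->
  orth mu A f -> L2 mu f' -> ae_eq2 mu f f' -> orth mu A f'.
Proof.
move=> AL [Lf fA] Lf' ff'; split => // g Ag.
by rewrite -(inner_ae ff')//; [exact: fA|exact: AL].
Qed.

Lemma orth_self (A : set (X -> R[i])) f : A f -> orth mu A f ->
  ae_eq2 mu f (cst 0).
Proof. by move=> Af [Lf /(_ _ Af)]; exact: inner_eq0. Qed.

Let subE f g : f \- g = (fun x => (-1) * g x + f x).
Proof. by apply/funext => x /=; rewrite mulN1r addrC. Qed.

Lemma orth_L2closure (A : set (X -> R[i])) k : A `<=` L2 mu ->
  orth mu A k -> orth mu (L2closure mu A) k.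
Proof.
move=> AL [Lk kA]; split => // g [Lg gcl].
set K := fine (\int[mu]_x (normc2 (k x))%:E).
have K0 : 0 <= K.
  by apply: fine_ge0; apply: integral_ge0 => x _; rewrite lee_fin normc2_ge0.
have main (t : R) : 0 < t -> `|Re (inner mu k g)| <= t * (K + 1) /\
    `|Im (inner mu k g)| <= t * (K + 1).
  move=> t0; have [r Ar gr] := gcl _ t0.
  have Lr := AL _ Ar; have Lgr := L2_sub Lg Lr.
  have kgr : inner mu k g = inner mu k (g \- r).
    rewrite (inner_conj Lk Lg) (inner_conj Lk Lgr); congr (_ ^*%C).
    rewrite subE inner_lin// [inner mu r k]inner_conj// kA//.
    by rewrite rmorph0 mulr0 add0r.
  have Ltk : L2 mu (fun x => t%:C * k x + cst 0 x) by apply: L2_lin => //; exact: L2_0.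
  have tk : inner mu (fun x => t%:C * k x + cst 0 x) (g \- r) =
      t%:C * inner mu k g.
    by rewrite inner_lin//; [rewrite inner0l// addr0 kgr|exact: L2_0].
  have := inner_bound Ltk Lgr; rewrite tk.
  have -> : fine (\int[mu]_x (normc2 (t%:C * k x + cst 0 x))%:E) = t ^+ 2 * K.
    rewrite /K -!/(fint _).
    rewrite (_ : (fun x => normc2 (t%:C * k x + cst 0 x)) =
      (fun x => t ^+ 2 * normc2 (k x) + 0 * normc2 (k x))).
      by rewrite fint_lin ?mul0r ?addr0//; exact: integrable_normc2.
    by apply/funext => x; rewrite /normc2; case: (k x) => ? ? /=; ring.
  have : fine (\int[mu]_x (normc2 ((g \- r) x))%:E) <= t ^+ 2.
    move: gr; rewrite /L2norm; set N := fine _ => Nt.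
    have N0 : 0 <= N.
      by apply: fine_ge0; apply: integral_ge0 => x _; rewrite lee_fin normc2_ge0.
    by rewrite -(sqr_sqrtr N0) lerXn2r// ?nnegrE ?sqrtr_ge0 ?ltW.
  set N := fine _; move: (inner mu k g) => [u v] /= Nt.
  rewrite !mul0r subr0 addr0 !normrM (gtr0_norm t0) => -[h1 h2].
  split; rewrite -(ler_pM2l t0).
    apply: le_trans h1 _; nra.
  apply: le_trans h2 _; nra.
have K1 : 0 < K + 1 by rewrite ltr_wpDl.
have arb (u : R) : (forall t, 0 < t -> `|u| <= t * (K + 1)) -> u = 0.
  move=> H; apply/eqP; rewrite -normr_le0; apply/ler_addgt0Pl => e e0.
  rewrite addr0; have := H (e / (K + 1)) (divr_gt0 e0 K1).
  by rewrite divfK// gt_eqF.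
move: main; case: (inner mu k g) => u v /= main.
by congr (_ +i* _); apply: arb => t /main[].
Qed.

End L2_theory.
Section reciprocal_theory.
Context {d} {X : measurableType d} {R : realType}.
Variable mu : {measure set X -> \bar R}.
Implicit Types (f g : X -> R[i]) (S T : operator X R).

Let subE f g : f \- g = (fun x => (-1) * g x + f x).
Proof. by apply/funext => x /=; rewrite mulN1r addrC. Qed.

Let ae_eq2_sub0 f g : ae_eq2 mu (f \- g) (cst 0) -> ae_eq2 mu f g.
Proof. by apply: filterS => x /eqP; rewrite subr_eq0 => /eqP. Qed.

Let ae_eq2_refl f : ae_eq2 mu f f.
Proof. exact: aeW. Qed.

Let ae_eq2_sym f g : ae_eq2 mu f g -> ae_eq2 mu g f.
Proof. by apply: filterS => x ->. Qed.

Let ae_eq2_trans f g h : ae_eq2 mu f g -> ae_eq2 mu g h -> ae_eq2 mu f h.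
Proof. by apply: filterS2 => x -> ->. Qed.

Let ranL T : is_operator mu T -> ran T `<=` L2 mu.
Proof. by move=> TO g [f /(op_L2 TO)[]]. Qed.

Let kerL T : is_operator mu T -> ker T `<=` L2 mu.
Proof. by move=> TO f /(op_L2 TO)[]. Qed.

Let op_sub T f g f' g' : is_operator mu T -> T (f, g) -> T (f', g') ->
  T (f \- f', g \- g').
Proof. by move=> TO Tfg Tfg'; rewrite !subE; apply: (op_lin TO). Qed.

Lemma is_proj_uniq (A : set (X -> R[i])) f p q : A `<=` L2 mu ->
  is_proj mu (orth mu A) f p -> is_proj mu (orth mu A) f q -> ae_eq2 mu p q.
Proof.
move=> AL [Ap pf] [Aq qf].
have oL : orth mu A `<=` L2 mu by move=> ? [].
apply: ae_eq2_sub0; apply: (@orth_self _ _ _ mu (orth mu A)).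
  by rewrite subE; exact: orth_lin.
rewrite (_ : p \- q = (f \- q) \- (f \- p)).
  by rewrite subE; exact: orth_lin.
by apply/funext => x /=; ring.
Qed.

Lemma is_reciprocal_ex T : is_operator mu T ->
  dom T = sum_set (ker T) (dom T `&` orth mu (ker T)) ->
  exists S, is_reciprocal mu T S.
Proof.
move=> TO Tdec.
pose N := ker T; pose Rg := ran T.
have NL : N `<=` L2 mu by exact: kerL.
have RL : Rg `<=` L2 mu by exact: ranL.
pose S : operator X R := [set fd | [/\ L2 mu fd.1, orth mu N fd.2 &
  exists2 q, T (fd.2, q) & orth mu Rg (fd.1 \- q)]].
have dec g q : T (g, q) -> exists n e, [/\ N n, orth mu N e, T (e, q) &
    g = n \+ e].
  move=> Tgq; have : dom T g by exists q.
  rewrite Tdec => -[n [e [Nn [_ eN] ge]]]; exists n, e; split=> //.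
  have := op_sub TO Tgq Nn; congr (T (_, _)).
    by apply/funext => x; rewrite ge /= addrAC subrr add0r.
  by apply/funext => x /=; rewrite subr0.
exists S; split.
- split.
  + move=> f e [/= Lf eN [q Teq _]]; split => //.
    by case: (op_L2 TO Teq).
  + move=> f e f' e' [/= Lf eN [q Teq fq]] Lf' Le' ff' ee'; split => //=.
      exact: orth_ae ee'.
    have [_ Lq] := op_L2 TO Teq.
    exists q; first exact: (op_ae TO Teq).
    apply: (orth_ae RL fq); first exact: L2_sub.
    by apply: filterS ff' => x /= ->.
  + move=> f e e' [/= Lf eN [q Teq fq]] [/= _ e'N [q' Teq' fq']].
    have Tqq := op_sub TO Teq Teq'.
    have qq0 : ae_eq2 mu (q \- q') (cst 0).
      apply: (@orth_self _ _ _ mu Rg); first by exists (e \- e').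
      rewrite (_ : q \- q' = (f \- q') \- (f \- q)).
        by rewrite subE; exact: orth_lin.
      by apply/funext => x /=; ring.
    apply: ae_eq2_sub0; apply: (@orth_self _ _ _ mu N).
      have [Lee _] := op_L2 TO Tqq.
      exact: (op_ae TO Tqq Lee (L2_0 mu) (ae_eq2_refl _) qq0).
    by rewrite subE; exact: orth_lin.
  + split => /=; [exact: L2_0|exact: orth_0|].
    exists (cst 0); first exact: (op_0 TO).
    rewrite (_ : _ \- _ = cst 0); first exact: orth_0.
    by apply/funext => x /=; rewrite subr0.
  + move=> a f e f' e' [/= Lf eN [q Teq fq]] [/= Lf' e'N [q' Teq' fq']].
    split => /=; [exact: L2_lin|exact: orth_lin|].
    exists (fun x => a * q x + q' x); first by apply: (op_lin TO).
    rewrite (_ : _ \- _ = (fun x => a * (f \- q) x + (f' \- q') x)).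
      exact: orth_lin.
    by apply/funext => x /=; ring.
- apply/seteqP; split => f.
    move=> [e [/= Lf eN [q Teq fq]]].
    exists q, (f \- q); split => //; first by exists e.
    by apply/funext => x /=; rewrite addrC subrK.
  move=> [q [k [[g Tgq] kR ->]]].
  have [n [e [Nn eN Teq _]]] := dec _ _ Tgq.
  exists e; split => //=.
    have := L2_lin 1 (RL _ (ex_intro _ _ Tgq)) (proj1 kR).
    by congr (L2 mu _); apply/funext => x /=; rewrite mul1r.
  exists q => //; rewrite (_ : _ \- _ = k)//.
  by apply/funext => x /=; rewrite addrAC subrr add0r.
- move=> f [e Sfe]; have [/= Lf eN [q Teq fq]] := Sfe.
  exists q; first by exists e.
  split; last exact: orth_L2closure.
  split; first by case: (op_L2 TO Teq).
  move=> eps e0; exists q; first by exists e.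
  rewrite /L2norm (_ : (fun x => _) = cst 0%E) ?integral0 ?sqrtr0//.
  by apply/funext => x; rewrite /normc2/= subrr/= expr0n/= addr0.
- move=> g [q Tgq].
  have [n [e [Nn eN Teq ge]]] := dec _ _ Tgq.
  have [_ Lq] := op_L2 TO Teq.
  exists e.
    exists q => //; split => //=; exists q => //.
    rewrite (_ : _ \- _ = cst 0); first exact: orth_0.
    by apply/funext => x /=; rewrite subrr.
  split => //.
  rewrite (_ : _ \- _ = n); last first.
    by apply/funext => x; rewrite ge /= addrK.
  split; first exact: NL.
  move=> y [Ly yN]; rewrite inner_conj ?yN ?rmorph0//; exact: NL.
- apply/seteqP; split => f.
    move=> [/= Lf _ [q Tq fq]].
    have [_ Lq] := op_L2 TO Tq.
    have q0 : ae_eq2 mu q (cst 0) := op_fun TO Tq (op_0 TO).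
    apply: (orth_ae RL fq Lf).
    by apply: filterS q0 => x /= ->; rewrite subr0.
  move=> fR; split => /=; [by case: fR|exact: orth_0|].
  exists (cst 0); first exact: (op_0 TO).
  rewrite (_ : _ \- _ = f)//.
  by apply/funext => x /=; rewrite subr0.
Qed.

Lemma is_reciprocal_uniq T S S' : is_operator mu T ->
  is_reciprocal mu T S -> is_reciprocal mu T S' -> S = S'.
Proof.
move=> TO; suff sub S1 S2 : is_reciprocal mu T S1 -> is_reciprocal mu T S2 ->
    S1 `<=` S2 by move=> HS HS'; apply/seteqP; split; exact: sub.
move=> H1 H2 [f s] S1fs.
have O1 := recip_op H1; have O2 := recip_op H2.
have : dom S1 f by exists s.
rewrite (recip_dom H1) => -[q [k [[g Tgq] kR fE]]].
have S1k : S1 (k, cst 0) by move: kR; rewrite -(recip_ker H1).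
have S2k : S2 (k, cst 0) by move: kR; rewrite -(recip_ker H2).
have [_ Lq] := op_L2 TO Tgq.
have gT : dom T g by exists q.
have get Si : is_reciprocal mu T Si -> Si (k, cst 0) ->
    exists2 p, Si (f, p) & is_proj mu (orth mu (ker T)) g p.
  move=> Hi Sik; have Oi := recip_op Hi.
  have [p [/= q' Tgq' Siqp] pj] := recip_r Hi gT.
  exists p => //.
  have qq' : ae_eq2 mu q' q := op_fun TO Tgq' Tgq.
  have [_ Lp] := op_L2 Oi Siqp.
  have Siq := op_ae Oi Siqp Lq Lp qq' (ae_eq2_refl p).
  have := op_lin Oi 1 Siq Sik; congr (Si (_, _)).
    by rewrite fE; apply/funext => x /=; rewrite mul1r.
  by apply/funext => x /=; rewrite mul1r addr0.
have [p1 S1p p1j] := get _ H1 S1k.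
have [p2 S2p p2j] := get _ H2 S2k.
have p12 := is_proj_uniq (kerL TO) p1j p2j.
have sp1 : ae_eq2 mu s p1 := op_fun O1 S1fs S1p.
have [Lf Ls] := op_L2 O1 S1fs.
apply: (op_ae O2 S2p Lf Ls (ae_eq2_refl f)).
exact: ae_eq2_sym (ae_eq2_trans sp1 p12).
Qed.

Lemma reciprocalP T : is_operator mu T ->
  dom T = sum_set (ker T) (dom T `&` orth mu (ker T)) ->
  is_reciprocal mu T (reciprocal mu T).
Proof.
by move=> TO Tdec; apply: (@xgetPex _ set0 (is_reciprocal mu T));
  exact: is_reciprocal_ex.
Qed.

End reciprocal_theory.

Section weighted_composition.
Context {d} {X : measurableType d} {R : realType}.
Variable mu : {measure set X -> \bar R}.
Implicit Types (phi : X -> X) (w f g : X -> R[i]) (u h : X -> \bar R).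

Definition density u : set X -> \bar R := fun D => (\int[mu]_(x in D) u x)%E.

Definition mu_w w : set X -> \bar R := density (fun x => (normc2 (w x))%:E).

Definition wco_well_defined phi w := pushforward (mu_w w) phi `<< mu.

Definition wco phi w : operator X R :=
  [set fg | [/\ L2 mu fg.1, L2 mu fg.2, L2 mu (fun x => w x * fg.1 (phi x))
     & ae_eq2 mu fg.2 (fun x => w x * fg.1 (phi x))]].

Definition wco_densely_defined phi w :=
  wco_well_defined phi w /\ dense_in_L2 mu (dom (wco phi w)).

Definition mulop w : operator X R :=
  [set fg | [/\ L2 mu fg.1, L2 mu fg.2, L2 mu (fun x => w x * fg.1 x)
     & ae_eq2 mu fg.2 (fun x => w x * fg.1 x)]].

(* [h] is a version of h_{phi,w} *)
Definition is_RN phi w h :=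
  [/\ measurable_fun setT h, forall x, (0 <= h x)%E &
      forall D, measurable D ->
        pushforward (mu_w w) phi D = (\int[mu]_(x in D) h x)%E].

(* [e] is a version of E_{phi,w}(f) for [f : X -> [0, oo]] *)
Definition is_condexp_ge0 phi w (f e : X -> \bar R) :=
  [/\ measurable_fun (setT : set (g_sigma_algebra_preimageType phi)) e,
      forall x, (0 <= e x)%E &
      forall D, measurable D ->
        (\int[mu_w w]_(x in phi @^-1` D) e x =
         \int[mu_w w]_(x in phi @^-1` D) f x)%E].

(* [e] is a version of E_{phi,w}(f) for [f] in some L^p(mu_w), 1 <= p < oo.
   Such an [f] is integrable on sets of finite measure only, hence the
   restriction on [D]; mu_w o phi^-1 is sigma-finite when the operator is
   densely defined, so [e] is unique up to mu_w-null sets. *)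
Definition is_condexp phi w (f e : X -> R[i]) :=
  @cmeasurable _ (g_sigma_algebra_preimageType phi) R e /\
  forall D, measurable D -> (mu_w w (phi @^-1` D) < +oo)%E ->
    cintegrable (mu_w w) (phi @^-1` D) e /\
    cintegral (mu_w w) (phi @^-1` D) e = cintegral (mu_w w) (phi @^-1` D) f.

(* [g] is a version of E_{phi,w}(f) o phi^-1, where [h] is h_{phi,w} *)
Definition is_condexp_inv phi w h (f g : X -> R[i]) :=
  [/\ cmeasurable g, {ae mu, forall x, h x = 0%E -> g x = 0} &
      exists2 e, is_condexp phi w f e & ae_eq2 (mu_w w) e (g \o phi)].

(* f_w *)
Definition cweight_div w f : X -> R[i] :=
  fun x => if w x == 0 then 0 else f x / w x.

End weighted_composition.

(* Main.v *)
Require Import Defs.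
From HB Require Import structures.
From mathcomp Require Import all_boot all_order all_algebra.
From mathcomp Require Import all_classical all_reals all_analysis.
From mathcomp Require Import measurable_realfun complex.
From mathcomp Require Import ring lra.
Import Order.TTheory GRing.Theory Num.Theory.
Import numFieldNormedType.Exports.
Local Open Scope classical_set_scope.
Local Open Scope ring_scope.

(** All the operators and conditional expectations of the statement are read
off one relation. For a weight [w] put [W s = w (s o phi)] ([wcomp]) and let [h]
be the density of the image under [phi] of the measure of density [|w|^2], so
that the integral of [|w|^2 (k o phi)] is the integral of [k h] for every [k]
([transfers], [cintegral_transfer]). Say that [wproj f s] holds when [W s] is
the orthogonal projection of [f] on the closure of the range of [C_{phi,w}],
with [s = 0] on [{h = 0}].

- The graph of the reciprocal of [C_{phi,w}] consists of the pairs [(f, s)] with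
  [wproj f s] and [s] in [L^2] ([reciprocal_wcoP]). Multiplication by [w] is the
  case [phi = id], so its reciprocal is [f |-> f_w] ([reciprocal_mulopP]).
- For [f] in [L^2], [wproj f s] also says that [s] is
  [E_{phi,w}(f_w) o phi^-1] ([wproj_condexp_inv], [condexp_inv_wproj]). Since
  [is_condexp_inv] determines [s] ([condexp_inv_uniq]), the second direction
  amounts to the existence of some [s] with [wproj f s] ([wproj_exists]). When
  [f_w >= 0] that [s] is [H / h], where [H] is the Radon-Nikodym density of the
  image of the measure of density [|w|^2 f_w], and testing against truncations
  of [s] bounds the norm of [W s] by that of [f].

Hence (a2) and (b1) both say that [wproj f s] for the weight [w], with [s] in
[L^2], implies [wproj f_w s] for the weight 1; and (b2) gives the reverse
implication that (a3) expresses.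

Let [g] be the density that goes with the weight 1. Then
[E_phi(|w|^2) = (h / g) o phi], and (c) becomes [|w|^2 (g o phi) = h o phi] on
[{w != 0}] ([weight_is_condexp], [condexp_weight_exists],
[condexp_weight_inv]). The link with (b1) and (b2) is the choice of test
functions: [(g / h) k] for the weight [w] and [k] for the weight 1 are both
paired with [s] to the integral of [s k g].

- (b1) implies (c): for [f = w 1_D] the same [s] serves both weights, so with
  [k] an indicator the integral of [|w|^2 (g / h) o phi] over [D] is the measure
  of [D]; this for all small [D] is (c) ([wproj_factors_condexp]).
- (c) implies (b2): under (c), [f] paired with the first test function and [f_w]
  paired with the second agree, so the two symbols have the same integrals and
  coincide ([condexp_weight_wproj_eq]). *)

Set Implicit Arguments.
Unset Strict Implicit.
Unset Printing Implicit Defensive.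

Local Notation Re := (@complex.Re _).
Local Notation Im := (@complex.Im _).

(** * Complex-valued measurable functions *)

Section complex_valued_functions.
Context {d} {X : measurableType d} {R : realType}.
Implicit Types (f g : X -> R[i]) (y z : R[i]).

Lemma complex_eqP y z : Re y = Re z -> Im y = Im z -> y = z.
Proof. by case: y z => a b [e t] /= -> ->. Qed.

Lemma normc2M y z : normc2 (y * z) = normc2 y * normc2 z.
Proof. by case: y z => a b [e t]; rewrite /normc2 /=; ring. Qed.

Lemma normc2_real (r : R) : normc2 (r%:C)%C = r ^+ 2.
Proof. by rewrite /normc2 /= expr0n /= addr0. Qed.

Lemma normc2_0 : normc2 (0 : R[i]) = 0.
Proof. by rewrite /normc2 /= expr0n /= addr0. Qed.

Lemma normc2_1 : normc2 (1 : R[i]) = 1.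
Proof. by rewrite /normc2 /= expr0n /= expr1n addr0. Qed.

Lemma normc2_neq0 z : (normc2 z != 0) = (z != 0).
Proof.
apply/idP/idP; apply: contra_neq; first by move=> ->; exact: normc2_0.
exact: normc2_eq0.
Qed.

Lemma mul_conjc z : z * (z^*)%C = (normc2 z)%:C%C.
Proof. by apply: complex_eqP; case: z => a b; rewrite /normc2 /=; ring. Qed.

Lemma conjcM y z : (y * z)^*%C = y^*%C * z^*%C.
Proof. exact: rmorphM. Qed.

Lemma conjcZ (r : R) z : (r%:C%C * z)^*%C = r%:C%C * z^*%C.
Proof. by rewrite conjcM conjc_real. Qed.

Lemma Re_mulr_real z (r : R) : Re (z * r%:C%C) = Re z * r.
Proof. by case: z => a b /=; rewrite mulr0 subr0. Qed.

Lemma Im_mulr_real z (r : R) : Im (z * r%:C%C) = Im z * r.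
Proof. by case: z => a b /=; rewrite mulr0 add0r. Qed.

Lemma cmeasurable_cst z : cmeasurable (cst z : X -> R[i]).
Proof. by split; exact: measurable_cst. Qed.

Lemma cmeasurableM f g : cmeasurable f -> cmeasurable g ->
  cmeasurable (fun x => f x * g x).
Proof.
move=> [f1 f2] [g1 g2]; split.
  rewrite (_ : _ \o _ = ((Re \o f) \* (Re \o g)) \- ((Im \o f) \* (Im \o g))).
    by apply: measurable_funB; exact: measurable_funM.
  by apply/funext => x /=; case: (f x) (g x) => ? ? [? ?].
rewrite (_ : _ \o _ = ((Re \o f) \* (Im \o g)) \+ ((Im \o f) \* (Re \o g))).
  by apply: measurable_funD; exact: measurable_funM.
by apply/funext => x /=; case: (f x) (g x) => ? ? [? ?].
Qed.

Lemma cmeasurable_conj f : cmeasurable f -> cmeasurable (fun x => (f x)^*%C).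
Proof.
move=> [f1 f2]; split.
  by rewrite (_ : _ \o _ = Re \o f)//; apply/funext => x /=; case: (f x).
rewrite (_ : _ \o _ = \- (Im \o f)); first exact: measurable_funN.
by apply/funext => x /=; case: (f x).
Qed.

Lemma cmeasurable_real (r : X -> R) : measurable_fun setT r ->
  cmeasurable (fun x => (r x)%:C%C).
Proof.
move=> mr; split; first exact: mr.
by rewrite (_ : _ \o _ = cst 0)//; exact: measurable_cst.
Qed.

Lemma cmeasurable_comp {d'} {Y : measurableType d'} (phi : Y -> X) f :
  measurable_fun setT phi -> cmeasurable f -> cmeasurable (f \o phi).
Proof.
by move=> mphi [f1 f2]; split; rewrite compA; exact: measurableT_comp.
Qed.

Lemma cmeasurableB f g : cmeasurable f -> cmeasurable g ->
  cmeasurable (f \- g).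
Proof.
move=> mf mg; rewrite (_ : _ \- _ = fun x => (-1) * g x + f x).
  exact: cmeasurable_lin.
by apply/funext => x /=; rewrite mulN1r addrC.
Qed.

Lemma measurable_funV (r : X -> R) : measurable_fun setT r ->
  (forall x, 0 <= r x) -> measurable_fun setT (fun x => (r x)^-1).
Proof.
move=> mr r0; rewrite (_ : (fun x => _) = fun x => r x `^ (-1)).
  exact: (measurableT_comp (measurable_powR (-1)) mr).
by apply/funext => x; rewrite powR_inv1.
Qed.

Lemma measurable_eq0 (r : X -> R) : measurable_fun setT r ->
  measurable [set x | r x = 0].
Proof.
move=> mr; rewrite -[X in measurable X]setTI.
exact: (mr measurableT _ (measurable_set1 0)).
Qed.

Lemma measurable_neq0 (r : X -> R) : measurable_fun setT r ->
  measurable [set x | r x != 0].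
Proof.
move=> /measurable_eq0/measurableC; congr measurable.
by apply/seteqP; split => x /= => [|] /eqP.
Qed.

Lemma measurable_le_cst (r : X -> R) (c : R) : measurable_fun setT r ->
  measurable [set x | r x <= c].
Proof.
move=> mr; rewrite -[X in measurable X]setTI.
have := mr measurableT _ (@measurable_itv R `]-oo, c]).
by congr (measurable (_ `&` _)); apply/seteqP; split => x /=; rewrite in_itv.
Qed.

Lemma measurable_neq0c f : cmeasurable f -> measurable [set x | f x != 0].
Proof.
move=> mf; have /measurableC := measurable_eq0 (measurable_normc2 mf).
congr measurable; apply/seteqP; split => x /=.
  by move=> H; apply/eqP => fx; apply: H; rewrite fx normc2_0.
by move=> fx /normc2_eq0/eqP; exact/negP.
Qed.

Lemma cmeasurable_cweight_div f g : cmeasurable f -> cmeasurable g ->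
  cmeasurable (cweight_div g f).
Proof.
move=> mf mg.
rewrite (_ : cweight_div g f = fun x =>
  (f x * (g x)^*%C) * (((normc2 (g x))^-1)%:C)%C).
  apply: cmeasurableM; first exact/cmeasurableM/cmeasurable_conj.
  apply: cmeasurable_real; apply: measurable_funV; first exact: measurable_normc2.
  by move=> x; exact: normc2_ge0.
apply/funext => x; rewrite /cweight_div; case: eqP => [->|/eqP gx].
  by rewrite normc2_0 invr0 mulr0.
apply: (mulIf gx); rewrite divfK//.
transitivity (f x * (g x * (g x)^*%C * ((normc2 (g x))^-1)%:C%C)); last by ring.
by rewrite mul_conjc -rmorphM/= mulfV ?mulr1// normc2_neq0.
Qed.

(** Multiplication by an indicator keeps the ring structure at hand, which a
patched function would hide from the inner products below. *)
Definition crestrict (A : set X) f : X -> R[i] := fun x => (\1_A x)%:C%C * f x.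

Lemma normc2_crestrict A f x : normc2 (crestrict A f x) = \1_A x * normc2 (f x).
Proof.
rewrite normc2M normc2_real; congr (_ * _).
by rewrite indicE; case: (_ \in _); rewrite ?expr1n ?expr0n.
Qed.

Lemma Re_crestrict A f x : Re (crestrict A f x) = \1_A x * Re (f x).
Proof. by rewrite /crestrict; case: (f x) => a b /=; rewrite mul0r subr0. Qed.

Lemma Im_crestrict A f x : Im (crestrict A f x) = \1_A x * Im (f x).
Proof. by rewrite /crestrict; case: (f x) => a b /=; rewrite mul0r addr0. Qed.

Lemma cmeasurable_crestrict A f : measurable A -> cmeasurable f ->
  cmeasurable (crestrict A f).
Proof.
move=> mA mf; apply: cmeasurableM => //; apply: cmeasurable_real.
exact: measurable_indic.
Qed.

End complex_valued_functions.

(** * Measures with a density *)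

Section density_measure.
Context {d} {X : measurableType d} {R : realType}.
Variable mu : {measure set X -> \bar R}.
Variables (u : X -> \bar R) (mu_ : measurable_fun setT u).
Hypothesis u0 : forall x, (0 <= u x)%E.

(** The proofs that [u] is measurable and nonnegative are arguments, so that the
measure structure can be inferred from the term. *)
Definition density_measure of measurable_fun setT u & forall x, (0 <= u x)%E :=
  density mu u.

Local Notation nu := (density_measure mu_ u0).

Let nu0 : nu set0 = 0%E. Proof. exact: integral_set0. Qed.

Let nu_ge0 D : (0 <= nu D)%E. Proof. by apply: integral_ge0 => x _. Qed.

Let nu_sigma : semi_sigma_additive nu.
Proof. exact: semi_sigma_additive_nng_induced. Qed.

HB.instance Definition _ := isMeasure.Build _ _ _ nu nu0 nu_ge0 nu_sigma.

End density_measure.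

Section integral_density.
Context {d} {X : measurableType d} {R : realType}.
Variable mu : {measure set X -> \bar R}.
Variables (u : X -> R) (mu_ : measurable_fun setT u).
Hypothesis u0 : forall x, 0 <= u x.

Let eu0 x : (0 <= (u x)%:E)%E. Proof. by rewrite lee_fin. Qed.

Let meu : measurable_fun setT (EFin \o u). Proof. exact/measurable_EFinP. Qed.

Local Notation nu := (density_measure mu meu eu0 : {measure set X -> \bar R}).

Import HBNNSimple.

Lemma integral_density_nnsfun (s : {nnsfun X >-> R}) :
  (\int[nu]_x (s x)%:E = \int[mu]_x ((s x)%:E * (u x)%:E))%E.
Proof.
rewrite integralT_nnsfun sintegralE.
transitivity (\int[mu]_x (\sum_(r \in range s)
    ((r * \1_(s @^-1` [set r]) x)%:E * (u x)%:E)))%E; last first.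
  apply: eq_integral => x _; rewrite -ge0_mule_fsuml => [|r]; last first.
    exact: nnfun_muleindic_ge0.
  by rewrite fsumEFin// -(fimfunE s x).
have ms r : measurable_fun setT (fun x => (r * \1_(s @^-1` [set r]) x)%:E).
  by apply/measurable_EFinP; exact: measurable_funM.
rewrite [RHS]ge0_integral_fsum//; last 2 first.
- by move=> r; exact: emeasurable_funM.
- by move=> r x _; rewrite mule_ge0// nnfun_muleindic_ge0.
apply: eq_fsbigr => r /[!inE] -[t _ sr].
have r0 : (0 <= r%:E)%E by rewrite lee_fin -sr.
under eq_integral do rewrite EFinM -muleA.
rewrite ge0_integralZl//; last 2 first.
- apply: emeasurable_funM => //; exact/measurable_EFinP.
- by move=> x _; rewrite mule_ge0// lee_fin.
congr (_ * _)%E; rewrite -[LHS]/(\int[mu]_(x in s @^-1` [set r]) (u x)%:E)%E.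
rewrite integral_mkcond; apply: eq_integral => x _.
by rewrite epatch_indic muleC.
Qed.

Lemma ge0_integral_density (D : set X) (f : X -> \bar R) : measurable D ->
  measurable_fun D f -> (forall x, D x -> 0 <= f x)%E ->
  (\int[density mu (EFin \o u)]_(x in D) f x =
   \int[mu]_(x in D) (f x * (u x)%:E))%E.
Proof.
move=> mD mf f0; rewrite -[LHS]/(\int[nu]_(x in D) f x)%E.
rewrite integral_mkcond [RHS]integral_mkcond.
set k := f \_ D; have mk : measurable_fun setT k by exact/(measurable_restrictT _ mD).
have k0 x : (0 <= k x)%E by exact: erestrict_ge0.
transitivity (\int[mu]_x (k x * (u x)%:E))%E; last first.
  apply: eq_integral => x _; rewrite /k !patchE.
  by case: (x \in D); rewrite ?mul0e.
pose s := nnsfun_approx measurableT mk.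
have sk x : (s n x)%:E @[n --> \oo] --> k x by exact: cvg_nnsfun_approx.
have snd x : {homo (s ^~ x) : m n / (m <= n)%N >-> m <= n}.
  by move=> m n mn; exact/lefP/nd_nnsfun_approx.
have ms n : measurable_fun setT (EFin \o s n) by exact/measurable_EFinP.
transitivity (limn (fun n => \int[nu]_x (s n x)%:E))%E.
  rewrite -monotone_convergence//; last 2 first.
  - by move=> n x _; rewrite lee_fin.
  - by move=> x _ m n mn; rewrite lee_fin snd.
  by apply: eq_integral => x _; apply/esym/cvg_lim => //; exact: sk.
under eq_fun do rewrite integral_density_nnsfun.
rewrite -monotone_convergence//; last 3 first.
- by move=> n; apply: emeasurable_funM; [exact: ms|exact: meu].
- by move=> n x _; rewrite mule_ge0 ?lee_fin.
- by move=> x _ m n mn; rewrite lee_wpmul2r ?lee_fin// snd.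
by apply: eq_integral => x _; apply/cvg_lim => //; apply: cvgeZr => //; exact: sk.
Qed.

Lemma integral_density (D : set X) (g : X -> R) : measurable D ->
  measurable_fun setT g ->
  (\int[density mu (EFin \o u)]_(x in D) (g x)%:E =
   \int[mu]_(x in D) (g x * u x)%:E)%E.
Proof.
move=> mD mg; have mG : measurable_fun D (EFin \o g).
  by apply/measurable_EFinP; exact: measurable_funTS.
pose nu : {measure set X -> \bar R} := density_measure mu meu eu0.
rewrite -[LHS]/(\int[nu]_(x in D) (g x)%:E)%E integralE [RHS]integralE.
rewrite [X in (X - _)%E]ge0_integral_density//; last exact: measurable_funepos.
rewrite [X in (_ - X)%E]ge0_integral_density//; last exact: measurable_funeneg.
congr (_ - _)%E; apply: eq_integral => x _.
  by rewrite !funeposE/= EFinM maxeMl ?mul0e ?lee_fin.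
by rewrite !funenegE/= -mulNr EFinM maxeMl ?mul0e ?lee_fin.
Qed.

Lemma integrable_density (D : set X) (g : X -> R) : measurable D ->
  measurable_fun setT g ->
  (density mu (EFin \o u)).-integrable D (EFin \o g) <->
  mu.-integrable D (fun x => (g x * u x)%:E).
Proof.
move=> mD mg.
have E : (\int[density mu (EFin \o u)]_(x in D) `|(g x)%:E| =
          \int[mu]_(x in D) `|(g x * u x)%:E|)%E.
  rewrite (integral_density (g := fun x => `|g x|))//; last first.
    exact: measurableT_comp.
  by apply: eq_integral => x _; rewrite abse_EFin normrM (ger0_norm (u0 _)).
split=> /integrableP[_ H]; apply/integrableP; split.
- by apply/measurable_EFinP; apply: measurable_funTS; exact: measurable_funM.
- by rewrite -E.
- by apply/measurable_EFinP; exact: measurable_funTS.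
- by rewrite E.
Qed.

End integral_density.

Section sigma_finite_density.
Context {d} {X : measurableType d} {R : realType}.

Lemma image_measure_exists (m : {measure set X -> \bar R}) (phi : X -> X) :
  measurable_fun setT phi ->
  exists nu : {measure set X -> \bar R}, forall D, nu D = m (phi @^-1` D).
Proof.
move=> mphi; unshelve eexists (pushforward m phi : {measure set X -> \bar R}).
  exact: mphi.
by [].
Qed.

Variables (mu : {sigma_finite_measure set X -> \bar R})
  (nu : {measure set X -> \bar R}).

(** The Radon-Nikodym theorem when [nu] too is only sigma-finite: [nu] is
finite on the pieces of a partition, and the densities of its restrictions add
up to a density of [nu], which is finite almost everywhere on each piece. *)
Lemma density_exists (F : (set X)^nat) : nu `<< mu ->
  (forall n, measurable (F n) /\ (nu (F n) < +oo)%E) -> \bigcup_n F n = setT ->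
  exists h : X -> R, [/\ measurable_fun setT h, forall x, 0 <= h x &
    forall D, measurable D -> nu D = (\int[mu]_(x in D) (h x)%:E)%E].
Proof.
move=> numu mF FT; pose E := seqDU F.
have mE n : measurable (E n).
  apply: measurableD; first by case: (mF n).
  by apply: bigsetU_measurable => k _; case: (mF k).
have nuE n : (nu (E n) < +oo)%E.
  rewrite (le_lt_trans _ (proj2 (mF n)))// le_measure ?inE//.
    by case: (mF n).
  exact: subset_seqDU.
have ET : \bigcup_n E n = setT by rewrite -FT [RHS]seqDU_bigcup_eq.
have tE := trivIset_seqDU F.
pose nu_ n : {finite_measure set X -> \bar R} := mfrestr (mE n) (nuE n).
have nu_mu n : nu_ n `<< mu.
  apply/null_content_dominatesP => S mS S0.
  move/null_content_dominatesP : numu; apply; first exact: measurableI.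
  by apply: (subset_measure0 _ _ _ S0) => //; exact: measurableI.
have [H_] := choice (fun n => radon_nikodym_sigma_finite (nu_mu n)).
move=> /all_and4[H0 Hfin iH HE].
have mH n : measurable_fun setT (H_ n) by exact: measurable_int (iH n).
pose H x := (\sum_(n <oo) H_ n x)%E.
have H_ge0 x : (0 <= H x)%E by exact: nneseries_ge0.
have mHs : measurable_fun setT H by exact: ge0_emeasurable_sum.
have intH D : measurable D -> (\int[mu]_(x in D) H x = nu D)%E.
  move=> mD; rewrite integral_nneseries//; last by move=> n; exact: measurable_funTS.
  rewrite -[in RHS](setIT D) -ET setI_bigcupr measure_bigcup//; last 2 first.
  - by move=> n _; exact: measurableI.
  - exact: trivIset_setIl.
  rewrite [RHS](_ : _ = \sum_(n <oo) nu (D `&` E n))%E; last first.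
    by apply: eq_eseriesl => // x; rewrite in_setT.
  by apply: eq_eseriesr => n _; rewrite -HE.
have Hae : {ae mu, forall x, H x = (fine (H x))%:E}.
  have : {ae mu, forall x n, E n x -> H x \is a fin_num}.
    apply/ae_foralln => n; apply: integrable_ae => //.
    apply/integrableP; split; first exact: measurable_funTS.
    by under eq_integral do rewrite gee0_abs//; rewrite intH.
  apply: filterS => x Hx; rewrite fineK//.
  have : setT x by []; rewrite -ET => -[n _]; exact: Hx.
exists (fine \o H); split => //.
- exact: measurableT_comp.
- by move=> x /=; exact: fine_ge0.
- move=> D mD; rewrite -intH//; apply: ae_eq_integral => //.
  + exact: measurable_funTS.
  + apply/measurable_EFinP; apply: measurable_funTS; exact: measurableT_comp.
  + by apply: filterS Hae => x.
Qed.

(** The sets on which a given function is bounded, cut down to finite measure,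
exhaust the space: the test functions below live on such sets, where all the
quantities at stake are bounded. *)
Lemma le_exhaustion (r : X -> R) : measurable_fun setT r ->
  exists E : (set X)^nat, [/\ forall n, measurable (E n),
    forall n, (mu (E n) < +oo)%E, nondecreasing_seq E, \bigcup_n E n = setT &
    forall n x, E n x -> r x <= n%:R].
Proof.
move=> mr; have /sigma_finiteP[F [FT ndF /all_and2[mF Foo]]] := sigma_finiteT mu.
exists (fun n => F n `&` [set x | r x <= n%:R]); split.
- by move=> n; apply: measurableI => //; exact: measurable_le_cst.
- move=> n; apply: le_lt_trans (Foo n); rewrite le_measure ?inE//.
  by apply: measurableI => //; exact: measurable_le_cst.
- move=> m n mn; apply/subsetPset => x [/= Fx rx]; split.
    by move/subsetPset: (ndF _ _ mn); exact.
  by rewrite /= (le_trans rx)// ler_nat.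
- apply/seteqP; split => // x _; have : setT x by [].
  rewrite FT => -[n _ Fx]; have [m rm] : exists m : nat, r x <= m%:R.
    exists (Num.truncn `|r x|).+1; apply: le_trans (ler_norm _) _.
    exact/ltW/truncnS_gt.
  exists (maxn n m) => //; split.
    by move/subsetPset: (ndF _ _ (leq_maxl n m)); exact.
  by rewrite /= (le_trans rm)// ler_nat leq_maxr.
- by move=> n x [].
Qed.

End sigma_finite_density.

(** * Moving a density along a map *)

Section transfer.
Context {d} {X : measurableType d} {R : realType}.
Variable mu : {measure set X -> \bar R}.
Variables (phi : X -> X) (rho h : X -> R).

(** [h mu] is the image of [rho mu] under [phi]; with [rho = |w|^2] this makes
[h] a real-valued version of [h_{phi,w}]. *)
Definition transfers :=
  [/\ measurable_fun setT phi,
      measurable_fun setT rho /\ (forall x, 0 <= rho x),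
      measurable_fun setT h /\ (forall x, 0 <= h x) &
      forall D, measurable D ->
        (\int[mu]_(x in phi @^-1` D) (rho x)%:E = \int[mu]_(x in D) (h x)%:E)%E].

Hypothesis T : transfers.

Let mphi : measurable_fun setT phi. Proof. by case: T. Qed.
Let mrho : measurable_fun setT rho. Proof. by case: T => ? []. Qed.
Let rho0 x : 0 <= rho x. Proof. by case: T => ? []. Qed.
Let mh : measurable_fun setT h. Proof. by case: T => ? ? []. Qed.
Let h0 x : 0 <= h x. Proof. by case: T => ? ? []. Qed.
Let hE D : measurable D ->
  (\int[mu]_(x in phi @^-1` D) (rho x)%:E = \int[mu]_(x in D) (h x)%:E)%E.
Proof. by case: T => _ _ _; exact. Qed.

Lemma ge0_integral_transfer (g : X -> \bar R) : measurable_fun setT g ->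
  (forall x, 0 <= g x)%E ->
  (\int[mu]_x (g (phi x) * (rho x)%:E) = \int[mu]_x (g x * (h x)%:E))%E.
Proof.
move=> mg g0.
have mer : measurable_fun setT (EFin \o rho) by exact/measurable_EFinP.
have er0 x : (0 <= (EFin \o rho) x)%E by rewrite lee_fin.
pose nu : {measure set X -> \bar R} := density_measure mu mer er0.
rewrite -(ge0_integral_density mu mrho rho0 measurableT)//; last first.
  exact: measurableT_comp.
rewrite -(ge0_integral_density mu mh h0 measurableT)//.
rewrite -[LHS]/(\int[nu]_(x in phi @^-1` setT) (g \o phi) x)%E.
rewrite -(ge0_integral_pushforward mphi)//.
have meh : measurable_fun setT (EFin \o h) by exact/measurable_EFinP.
have eh0 x : (0 <= (EFin \o h) x)%E by rewrite lee_fin.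
apply: (eq_measure_integral (density_measure mu meh eh0)) => A mA _.
exact: hE.
Qed.

(** The positive and negative parts transfer separately, so the two integrals
agree even when they do not converge. *)
Lemma integral_transfer (g : X -> R) : measurable_fun setT g ->
  (\int[mu]_x (g (phi x) * rho x)%:E = \int[mu]_x (g x * h x)%:E)%E.
Proof.
move=> mg; rewrite integralE [RHS]integralE.
have aux (a b : R) : 0 <= b -> (maxe (a * b)%:E 0 = (maxe a%:E 0) * b%:E)%E.
  by move=> b0; rewrite EFinM maxeMl// ?mul0e.
have auxN (a b : R) : 0 <= b -> (maxe (- (a * b)%:E) 0 = (maxe (- a%:E) 0) * b%:E)%E.
  by move=> b0; rewrite -!EFinN -mulNr aux.
have mG : measurable_fun setT (EFin \o g) by exact/measurable_EFinP.
congr (_ - _)%E.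
  rewrite (_ : funepos _ = fun x => ((EFin \o g)^\+ (phi x) * (rho x)%:E)%E).
    rewrite ge0_integral_transfer//; last exact: measurable_funepos.
    by apply: eq_integral => x _; rewrite !funeposE/= aux.
  by apply/funext => x; rewrite !funeposE/= aux.
rewrite (_ : funeneg _ = fun x => ((EFin \o g)^\- (phi x) * (rho x)%:E)%E).
  rewrite ge0_integral_transfer//; last exact: measurable_funeneg.
  by apply: eq_integral => x _; rewrite !funenegE/= auxN.
by apply/funext => x; rewrite !funenegE/= auxN.
Qed.

Lemma integrable_transfer (g : X -> R) : measurable_fun setT g ->
  mu.-integrable setT (fun x => (g (phi x) * rho x)%:E) <->
  mu.-integrable setT (fun x => (g x * h x)%:E).
Proof.
move=> mg.
have E : (\int[mu]_x `|(g (phi x) * rho x)%:E| =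
          \int[mu]_x `|(g x * h x)%:E|)%E.
  under eq_integral do rewrite abse_EFin normrM (ger0_norm (rho0 _)).
  under [RHS]eq_integral do rewrite abse_EFin normrM (ger0_norm (h0 _)).
  by rewrite (integral_transfer (g := fun x => `|g x|))//; exact: measurableT_comp.
split=> /integrableP[_ H]; apply/integrableP; split.
- by apply/measurable_EFinP; exact: measurable_funM.
- by rewrite -E.
- apply/measurable_EFinP; apply: measurable_funM => //.
  exact: measurableT_comp.
- by rewrite E.
Qed.

Lemma cintegral_transfer (g : X -> R[i]) : cmeasurable g ->
  cintegral mu setT (fun x => g (phi x) * (rho x)%:C%C) =
  cintegral mu setT (fun x => g x * (h x)%:C%C).
Proof.
move=> [m1 m2]; rewrite /cintegral.
congr (fine _ +i* fine _)%C.
  transitivity (\int[mu]_x ((Re \o g) (phi x) * rho x)%:E)%E.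
    by apply: eq_integral => x _; rewrite Re_mulr_real.
  rewrite integral_transfer//.
  by apply: eq_integral => x _; rewrite Re_mulr_real.
transitivity (\int[mu]_x ((Im \o g) (phi x) * rho x)%:E)%E.
  by apply: eq_integral => x _; rewrite Im_mulr_real.
rewrite integral_transfer//.
by apply: eq_integral => x _; rewrite Im_mulr_real.
Qed.

Lemma cintegrable_transfer (g : X -> R[i]) : cmeasurable g ->
  cintegrable mu setT (fun x => g (phi x) * (rho x)%:C%C) <->
  cintegrable mu setT (fun x => g x * (h x)%:C%C).
Proof.
move=> [m1 m2]; rewrite /cintegrable.
have := integrable_transfer m1; have := integrable_transfer m2.
under [X in mu.-integrable _ X <-> _]eq_fun do rewrite /= -Im_mulr_real.
under [X in _ <-> mu.-integrable _ X]eq_fun do rewrite /= -Im_mulr_real.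
move=> Hi.
under [X in mu.-integrable _ X <-> _]eq_fun do rewrite /= -Re_mulr_real.
under [X in _ <-> mu.-integrable _ X]eq_fun do rewrite /= -Re_mulr_real.
by move=> Hr; rewrite Hr Hi.
Qed.

(** The part of [{rho != 0}] that [phi] sends into a null set, or into
[{h = 0}], has [rho mu]-measure zero, as the integral of [h] over the target
vanishes. *)
Lemma ae_transfer (P : X -> Prop) : {ae mu, forall x, h x != 0 -> P x} ->
  {ae mu, forall x, rho x != 0 -> P (phi x)}.
Proof.
move=> [N [mN N0 NP]].
pose M := N `|` [set x | h x = 0].
have mM : measurable M.
  apply: measurableU => //; rewrite -[X in measurable X]setTI.
  exact: (mh measurableT (measurable_set1 0)).
have mpM : measurable (phi @^-1` M).
  by rewrite -[X in measurable X]setTI; exact: mphi.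
have : (\int[mu]_(x in phi @^-1` M) `|(rho x)%:E| = 0)%E.
  under eq_integral do rewrite gee0_abs ?lee_fin//.
  rewrite hE//.
  transitivity (\int[mu]_(x in M) (cst 0%E) x)%E; last by rewrite integral0.
  apply: ae_eq_integral => //.
    by apply/measurable_EFinP; exact: measurable_funTS.
  exists N; split => // x /= /not_implyP[[//|/= hx]]; by rewrite hx.
move/ae_eq_integral_abs => -[//||N' [mN' N'0 N'P]].
  by apply/measurable_EFinP; exact: measurable_funTS.
exists N'; split => // x /= /not_implyP[rx nP]; apply: N'P => /= H.
have [Mx|Mx] := pselect (M (phi x)).
  by move/eqP: rx; case; apply: EFin_inj; exact: H Mx.
apply: nP; apply: contrapT => nP; apply: Mx.
have [hx|hx] := eqVneq (h (phi x)) 0; first by right.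
by left; apply: NP => /= /(_ hx).
Qed.

Lemma ae_transfer_neq0 : {ae mu, forall x, rho x != 0 -> h (phi x) != 0}.
Proof. by apply: (ae_transfer (P := fun y => h y != 0)); exact: aeW. Qed.

Lemma ae_transfer_inv (P : X -> Prop) : measurable [set x | P x] ->
  {ae mu, forall x, rho x != 0 -> P (phi x)} ->
  {ae mu, forall x, h x != 0 -> P x}.
Proof.
move=> mP H; pose M := ~` [set x | P x].
have mM : measurable M by exact: measurableC.
have mpM : measurable (phi @^-1` M).
  by rewrite -[X in measurable X]setTI; exact: mphi.
have : (\int[mu]_(x in M) `|(h x)%:E| = 0)%E.
  under eq_integral do rewrite gee0_abs ?lee_fin//.
  rewrite -hE//.
  transitivity (\int[mu]_(x in phi @^-1` M) (cst 0%E) x)%E; last by rewrite integral0.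
  apply: ae_eq_integral => //.
    by apply/measurable_EFinP; exact: measurable_funTS.
  apply: filterS H => x H Mx /=; congr EFin; apply: contrapT => /eqP/H.
  exact: Mx.
move/ae_eq_integral_abs => -[//||N' [mN' N'0 N'P]].
  by apply/measurable_EFinP; exact: measurable_funTS.
exists N'; split => // x /= /not_implyP[hx nP]; apply: N'P => /= H'.
by move/eqP: hx; case; apply: EFin_inj; exact: H' nP.
Qed.

End transfer.

(** * Square-integrable functions *)

Section L2_lemmas.
Context {d} {X : measurableType d} {R : realType}.
Variable mu : {measure set X -> \bar R}.
Implicit Types (f g : X -> R[i]).

Lemma L2_le (C : R) f g : cmeasurable f -> L2 mu g ->
  (forall x, normc2 (f x) <= C * normc2 (g x)) -> L2 mu f.
Proof.
move=> mf Lg fg; apply: (L2_bound mf _ fg).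
rewrite (_ : _ \o _ = fun x => (C%:E * (normc2 (g x))%:E)%E).
  by apply: integrableZl => //; exact: L2_integrable.
by apply/funext => x; rewrite /= EFinM.
Qed.

Lemma L2_bounded (C : R) (D : set X) f : measurable D -> (mu D < +oo)%E ->
  cmeasurable f -> (forall x, normc2 (f x) <= C * \1_D x) -> L2 mu f.
Proof.
move=> mD Doo mf fC; apply: (L2_bound mf _ fC).
rewrite (_ : _ \o _ = fun x => (C%:E * (\1_D x)%:E)%E).
  apply: integrableZl => //; apply/integrableP; split.
    by apply/measurable_EFinP; exact: measurable_indic.
  under eq_integral do rewrite gee0_abs ?lee_fin//.
  by rewrite integral_indic// setIT.
by apply/funext => x; rewrite /= EFinM.
Qed.

Lemma L2_ae f g : L2 mu f -> cmeasurable g -> ae_eq2 mu f g -> L2 mu g.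
Proof.
move=> [mf fi] mg fg; split => //; apply: le_lt_trans fi.
rewrite le_eqVlt; apply/orP; left; apply/eqP; apply: ae_eq_integral => //.
- by apply/measurable_EFinP; exact: measurable_normc2.
- by apply/measurable_EFinP; exact: measurable_normc2.
- by apply: filterS fg => x ->.
Qed.

Lemma L2_crestrict A f : measurable A -> L2 mu f -> L2 mu (crestrict A f).
Proof.
move=> mA Lf; apply: (@L2_le 1 _ f) => //.
  by apply: cmeasurable_crestrict => //; case: Lf.
by move=> x; rewrite normc2_crestrict ler_wpM2r ?normc2_ge0.
Qed.

Lemma cintegral_ae f g : cmeasurable f -> cmeasurable g -> ae_eq2 mu f g ->
  cintegral mu setT f = cintegral mu setT g.
Proof.
move=> [f1 f2] [g1 g2] fg; rewrite /cintegral.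
by congr (fine _ +i* fine _)%C; apply: ae_eq_integral => //;
  try (by apply/measurable_EFinP); apply: filterS fg => x ->.
Qed.

Lemma cintegrable_ae f g : cmeasurable g -> ae_eq2 mu f g ->
  cintegrable mu setT f -> cintegrable mu setT g.
Proof.
move=> [g1 g2] fg [if1 if2]; split.
  apply/integrableP; split; first exact/measurable_EFinP.
  have /integrableP[m1] := if1; apply: le_lt_trans.
  rewrite le_eqVlt; apply/orP; left; apply/eqP; apply: ae_eq_integral => //.
  - by apply: measurableT_comp => //; exact/measurable_EFinP.
  - by apply: measurableT_comp => //; exact/measurable_EFinP.
  - by apply: filterS fg => x ->.
apply/integrableP; split; first exact/measurable_EFinP.
have /integrableP[m1] := if2; apply: le_lt_trans.
rewrite le_eqVlt; apply/orP; left; apply/eqP; apply: ae_eq_integral => //.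
- by apply: measurableT_comp => //; exact/measurable_EFinP.
- by apply: measurableT_comp => //; exact/measurable_EFinP.
- by apply: filterS fg => x ->.
Qed.

Lemma inner_eq_ae f g f' g' : cmeasurable f -> cmeasurable g ->
  cmeasurable f' -> cmeasurable g' ->
  {ae mu, forall x, f x * (g x)^*%C = f' x * (g' x)^*%C} ->
  inner mu f g = inner mu f' g'.
Proof.
by move=> mf mg mf' mg' H; apply: cintegral_ae => //;
  apply: cmeasurableM => //; exact: cmeasurable_conj.
Qed.

Lemma inner_eq_pointwise f g f' g' :
  (forall x, f x * (g x)^*%C = f' x * (g' x)^*%C) ->
  inner mu f g = inner mu f' g'.
Proof. by move=> H; rewrite /inner; congr cintegral; exact/funext. Qed.

Lemma innerB f f' g : L2 mu f -> L2 mu f' -> L2 mu g ->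
  inner mu (f \- f') g = inner mu f g - inner mu f' g.
Proof.
move=> Lf Lf' Lg; rewrite (_ : _ \- _ = fun x => (-1) * f' x + f x).
  by rewrite inner_lin// mulN1r addrC.
by apply/funext => x /=; rewrite mulN1r addrC.
Qed.

Lemma Re_inner f : Re (inner mu f f) = fine (\int[mu]_x (normc2 (f x))%:E).
Proof.
rewrite /inner /cintegral /=; congr fine; apply: eq_integral => x _.
by rewrite mul_conjc.
Qed.

(** Bessel's inequality: the hypothesis says that [f - g] is orthogonal to
[g]. *)
Lemma bessel f g : L2 mu f -> L2 mu g -> inner mu f g = inner mu g g ->
  (\int[mu]_x (normc2 (g x))%:E <= \int[mu]_x (normc2 (f x))%:E)%E.
Proof.
move=> Lf Lg fg; have LB := L2_sub Lf Lg.
have fin (k : X -> R[i]) : L2 mu k ->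
    (\int[mu]_x (normc2 (k x))%:E)%E \is a fin_num.
  by move=> Lk; apply: integrable_fin_num => //; exact: L2_integrable.
rewrite -(fineK (fin _ Lf)) -(fineK (fin _ Lg)) lee_fin -subr_ge0.
have gfg : inner mu g (f \- g) = 0.
  by rewrite inner_conj// innerB// fg subrr rmorph0.
have gf : inner mu g f = inner mu g g.
  by rewrite inner_conj// fg -inner_conj.
have : inner mu (f \- g) (f \- g) = (inner mu f f - inner mu g g)^*%C.
  by rewrite [LHS]innerB// gfg subr0 inner_conj// innerB// gf.
move/(congr1 Re); rewrite Re_inner => E.
rewrite -!Re_inner; move: E; case: (inner mu f f) (inner mu g g) => a b [s t] /= <-.
by apply: fine_ge0; apply: integral_ge0 => x _; rewrite lee_fin normc2_ge0.
Qed.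

Lemma L2_exhaust (M : \bar R) f (E : (set X)^nat) : cmeasurable f ->
  (M < +oo)%E -> (forall n, measurable (E n)) -> nondecreasing_seq E ->
  \bigcup_n E n = setT ->
  (forall n, \int[mu]_x (normc2 (crestrict (E n) f x))%:E <= M)%E -> L2 mu f.
Proof.
move=> mf Moo mE ndE ET H; split => //; apply: le_lt_trans Moo.
have mn : measurable_fun setT (fun x => (normc2 (f x))%:E).
  by apply/measurable_EFinP; exact: measurable_normc2.
have := @ge0_nondecreasing_set_cvg_integral _ _ _ E
  (fun x => (normc2 (f x))%:E) mu ndE mE
  (fun i => measurable_funTS mn)
  (fun i x _ => (normc2_ge0 (f x) : (0 <= (normc2 (f x))%:E)%E)).
rewrite ET => /cvg_lim <- //; apply: lime_le.
  apply: ereal_nondecreasing_is_cvgn.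
  apply: ge0_nondecreasing_set_nondecreasing_integral => // i.
    exact: measurable_funTS.
  by move=> x _; rewrite lee_fin normc2_ge0.
apply: nearW => n; apply: le_trans (H n).
rewrite integral_mkcond le_eqVlt; apply/orP; left; apply/eqP.
apply: eq_integral => x _; rewrite normc2_crestrict patchE indicE.
by case: (x \in E n); rewrite ?mul1r ?mul0r.
Qed.

Lemma integral_exhaust0 (r : X -> R) (E : (set X)^nat) :
  mu.-integrable setT (EFin \o r) -> (forall n, measurable (E n)) ->
  nondecreasing_seq E -> \bigcup_n E n = setT ->
  (forall n, fine (\int[mu]_x (\1_(E n) x * r x)%:E) = 0) ->
  fine (\int[mu]_x (r x)%:E) = 0.
Proof.
move=> ir mE ndE ET H.
have [/measurable_EFinP mr _] := integrableP _ _ _ ir.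
have mi n : measurable_fun setT (fun x => (\1_(E n) x * r x)%:E).
  by apply/measurable_EFinP; exact: measurable_funM.
have b n x : `|\1_(E n) x * r x| <= `|r x|.
  by rewrite indicE; case: (_ \in _); rewrite ?mul1r// mul0r normr0.
have mer : measurable_fun setT (EFin \o r) by exact/measurable_EFinP.
have cv : {ae mu, forall x, setT x ->
    (\1_(E n) x * r x)%:E @[n --> \oo] --> (EFin \o r) x}.
  apply: aeW => x _; have : setT x by []; rewrite -ET => -[N _ Nx].
  apply: cvg_near_cst; near=> n; rewrite indicE mem_set ?mul1r//.
  have Nn : (N <= n)%N by near: n; exact: nbhs_infty_ge.
  by move/subsetPset: (ndE _ _ Nn); exact.
have dom : {ae mu, forall x n, setT x ->
    (`|(\1_(E n) x * r x)%:E| <= (EFin \o (fun x => `|r x|)%R) x)%E}.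
  by apply: aeW => x n _; rewrite abse_EFin lee_fin.
have [_ _ /cvg_lim] := dominated_convergence measurableT mi mer cv
  (integrable_norm ir) dom.
move=> <- //.
rewrite (_ : (fun n => _) = cst 0%E) ?lim_cst//.
apply/funext => n /=; rewrite -[LHS]fineK ?H//.
apply: integrable_fin_num => //; apply: le_integrable ir => //.
by move=> x _; rewrite lee_fin.
Unshelve. all: by end_near. Qed.

Lemma cintegral_exhaust0 f (E : (set X)^nat) :
  cintegrable mu setT f -> (forall n, measurable (E n)) ->
  nondecreasing_seq E -> \bigcup_n E n = setT ->
  (forall n, cintegral mu setT (fun x => (\1_(E n) x)%:C%C * f x) = 0) ->
  cintegral mu setT f = 0.
Proof.
move=> [fr fi] mE ndE ET H; rewrite /cintegral.
apply: complex_eqP => /=; apply: (integral_exhaust0 _ mE ndE ET) => // n;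
  have [Hr Hi] := H n.
  rewrite -[RHS]Hr; congr fine; apply: eq_integral => x _.
  by case: (f x) => a b /=; rewrite mul0r subr0.
rewrite -[RHS]Hi; congr fine; apply: eq_integral => x _.
by case: (f x) => a b /=; rewrite mul0r addr0.
Qed.

Lemma cintegral_ae_eq (B : set X) f g : measurable B ->
  cmeasurable f -> cmeasurable g ->
  cintegrable mu setT (crestrict B f) -> cintegrable mu setT (crestrict B g) ->
  (forall A, measurable A -> A `<=` B ->
    cintegral mu setT (crestrict A f) = cintegral mu setT (crestrict A g)) ->
  {ae mu, forall x, B x -> f x = g x}.
Proof.
move=> mB [f1 f2] [g1 g2] [if1 if2] [ig1 ig2] H.
have aux (u v : X -> R) : measurable_fun setT u -> measurable_fun setT v ->
    mu.-integrable setT (fun x => (\1_B x * u x)%:E) ->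
    mu.-integrable setT (fun x => (\1_B x * v x)%:E) ->
    (forall A, measurable A -> A `<=` B ->
      fine (\int[mu]_x (\1_A x * u x)%:E) = fine (\int[mu]_x (\1_A x * v x)%:E)) ->
    {ae mu, forall x, B x -> u x = v x}.
  move=> mu' mv iu iv uv.
  have restr (A : set X) (r : X -> R) :
      (\int[mu]_(x in A) (r x)%:E = \int[mu]_x (\1_A x * r x)%:E)%E.
    rewrite integral_mkcond; apply: eq_integral => x _.
    by rewrite patchE indicE; case: (x \in A); rewrite ?mul1r ?mul0r.
  have irestr (A : set X) (r : X -> R) : measurable A -> A `<=` B ->
      measurable_fun setT r -> mu.-integrable setT (fun x => (\1_B x * r x)%:E) ->
      mu.-integrable setT (fun x => (\1_A x * r x)%:E).
    move=> mA AB mr; apply: le_integrable => //.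
      by apply/measurable_EFinP; exact: measurable_funM.
    move=> x _; rewrite lee_fin !indicE; case: (boolP (x \in A)) => xA.
      by rewrite (_ : x \in B)// inE; apply: AB; rewrite inE in xA.
    by rewrite mul0r normr0.
  have iuB : mu.-integrable B (EFin \o u).
    apply/integrable_mkcond => //; apply: eq_integrable iu => // x _.
    by rewrite patchE indicE; case: (x \in B); rewrite ?mul1r ?mul0r.
  have mvB : measurable_fun B (EFin \o v).
    by apply/measurable_EFinP; exact: measurable_funTS.
  have : ae_eq mu B (EFin \o u) (EFin \o v).
    apply: integral_ae_eq => // A AB mA.
    have fin (r : X -> R) : measurable_fun setT r ->
        mu.-integrable setT (fun x => (\1_B x * r x)%:E) ->
        (\int[mu]_x (\1_A x * r x)%:E)%E \is a fin_num.
      by move=> mr ir; apply: integrable_fin_num => //; exact: irestr.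
    rewrite (restr A u) (restr A v) -(fineK (fin u mu' iu)) uv//.
    by rewrite fineK// fin.
  by apply: filterS => x /= E xB; apply: EFin_inj; exact: E.
have HR : {ae mu, forall x, B x -> Re (f x) = Re (g x)}.
  apply: aux => //.
  - by apply: eq_integrable if1 => // x _; rewrite Re_crestrict.
  - by apply: eq_integrable ig1 => // x _; rewrite Re_crestrict.
  - move=> A mA AB; have [] := H A mA AB.
    by under eq_integral do rewrite Re_crestrict;
       under [X in _ = fine X -> _]eq_integral do rewrite Re_crestrict.
have HI : {ae mu, forall x, B x -> Im (f x) = Im (g x)}.
  apply: aux => //.
  - by apply: eq_integrable if2 => // x _; rewrite Im_crestrict.
  - by apply: eq_integrable ig2 => // x _; rewrite Im_crestrict.
  - move=> A mA AB; have [] := H A mA AB => _.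
    by under eq_integral do rewrite Im_crestrict;
       under [X in _ = fine X -> _]eq_integral do rewrite Im_crestrict.
by apply: filterS2 HR HI => x hr hi Bx; apply: complex_eqP; [exact: hr|exact: hi].
Qed.

End L2_lemmas.

(** * The graph of a reciprocal *)

Section reciprocal_graph.
Context {d} {X : measurableType d} {R : realType}.
Variable mu : {measure set X -> \bar R}.

(** The reciprocal inverts [T] on its range, choosing the preimage orthogonal
to the kernel, and kills the orthogonal complement of the range. *)
Lemma is_reciprocal_graph (T S : operator X R) (f s : X -> R[i]) :
  is_operator mu T -> is_reciprocal mu T S ->
  S (f, s) <-> [/\ L2 mu f, orth mu (ker T) s &
    exists2 q, T (s, q) & orth mu (ran T) (f \- q)].
Proof.
move=> TO H; have SO := recip_op H.
have refl (g : X -> R[i]) : ae_eq2 mu g g by exact: aeW.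
have kL : ker T `<=` L2 mu by move=> g /(op_L2 TO)[].
have rL : ran T `<=` L2 mu by move=> g [e /(op_L2 TO)[]].
have ran_orth g : orth mu (L2closure mu (ran T)) g -> orth mu (ran T) g.
  move=> [Lg gR]; split => // y Ry; apply: gR; split; first exact: rL.
  move=> e e0; exists y => //.
  rewrite /L2norm (_ : (fun x => _) = cst 0%E) ?integral0 ?sqrtr0//.
  by apply/funext => x; rewrite /= subrr normc2_0.
have add f1 s1 f2 s2 f3 s3 : S (f1, s1) -> S (f2, s2) ->
    f1 \+ f2 = f3 -> s1 \+ s2 = s3 -> S (f3, s3).
  move=> S1 S2 <- <-; have := op_lin SO 1 S1 S2.
  by congr (S (_, _)); apply/funext => x /=; rewrite mul1r.
split.
  move=> Sfs; have [Lf Ls] := op_L2 SO Sfs.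
  have [p [/= s' Sfs' Ts'p] [_ /ran_orth fp]] := recip_l H (ex_intro _ _ Sfs).
  have ss' := op_fun SO Sfs' Sfs.
  have [_ Lp] := op_L2 TO Ts'p.
  have Tsp := op_ae TO Ts'p Ls Lp ss' (refl p).
  have [p2 [/= q Tsq Sqp2] [p2N _]] := recip_r H (ex_intro _ _ Tsp).
  have pq := op_fun TO Tsq Tsp.
  have [_ Lp2] := op_L2 SO Sqp2.
  have Spp2 := op_ae SO Sqp2 Lp Lp2 pq (refl p2).
  have Sk : S (f \- p, cst 0) by move: fp; rewrite -(recip_ker H).
  have Sfp2 : S (f, p2).
    apply: (add _ _ _ _ _ _ Spp2 Sk); apply/funext => x /=.
      by rewrite addrC subrK.
    by rewrite addr0.
  split => //; last by exists p.
  by apply: (orth_ae kL p2N Ls); exact: (op_fun SO Sfp2 Sfs).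
move=> [Lf sN [q Tsq fq]]; have [Ls Lq] := op_L2 TO Tsq.
have Sk : S (f \- q, cst 0) by move: fq; rewrite -(recip_ker H).
have [p [/= q' Tsq' Sq'p] pj] := recip_r H (ex_intro _ _ Tsq).
have qq' := op_fun TO Tsq' Tsq.
have sj : is_proj mu (orth mu (ker T)) s s.
  split => //; rewrite (_ : s \- s = cst 0); last first.
    by apply/funext => x /=; rewrite subrr.
  by apply: orth_0 => g [].
have ps := is_proj_uniq kL pj sj.
have Sqs := op_ae SO Sq'p Lq Ls qq' ps.
apply: (add _ _ _ _ _ _ Sqs Sk); apply/funext => x /=.
  by rewrite addrC subrK.
by rewrite addr0.
Qed.

End reciprocal_graph.

(** * Weighted composition operators *)

Section weighted_composition.
Context {d} {X : measurableType d} {R : realType}.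
Variable mu : {sigma_finite_measure set X -> \bar R}.
Variables (phi : X -> X) (w : X -> R[i]) (h : X -> R).
Hypotheses (mw : cmeasurable w)
  (T : transfers mu phi (fun x => normc2 (w x)) h).
Implicit Types f g k s : X -> R[i].

(** The operator [wco phi w] freed from its domain, so that symbols outside
[L^2] can be handled too. *)
Definition wcomp (phi : X -> X) (w f : X -> R[i]) : X -> R[i] :=
  fun x => w x * f (phi x).

Local Notation W := (wcomp phi w).
Local Notation Cw := (wco mu phi w).

Let mphi : measurable_fun setT phi. Proof. by case: T. Qed.
Let mh : measurable_fun setT h. Proof. by case: T => ? ? []. Qed.
Let h0 x : 0 <= h x. Proof. by case: T => ? ? []. Qed.
Let mphiE A : measurable A -> measurable (phi @^-1` A).
Proof. by move=> mA; rewrite -[X in measurable X]setTI; exact: mphi. Qed.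

Let w0P x : (normc2 (w x) != 0) = (w x != 0). Proof. exact: normc2_neq0. Qed.

Lemma cmeasurable_wcomp f : cmeasurable f -> cmeasurable (W f).
Proof. by move=> mf; apply: cmeasurableM => //; exact: cmeasurable_comp mf. Qed.

Lemma wcomp_lin a f g : W (fun x => a * f x + g x) = fun x => a * W f x + W g x.
Proof. by apply/funext => x; rewrite /wcomp; ring. Qed.

Lemma wcomp_indic A : W (fun x => (\1_A x)%:C%C) = crestrict (phi @^-1` A) w.
Proof. by apply/funext => x; rewrite /wcomp /crestrict !indicE mulrC. Qed.

Lemma wcomp_crestrict A f : W (crestrict A f) = crestrict (phi @^-1` A) (W f).
Proof. by apply/funext => x; rewrite /wcomp /crestrict !indicE mulrCA. Qed.

Lemma integral_normc2_wcomp f : cmeasurable f ->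
  (\int[mu]_x (normc2 (W f x))%:E = \int[mu]_x (normc2 (f x) * h x)%:E)%E.
Proof.
move=> mf; rewrite -(integral_transfer T (g := fun x => normc2 (f x))); last first.
  exact: measurable_normc2.
by apply: eq_integral => x _; rewrite normc2M mulrC.
Qed.

(** Bounded functions supported where [h] is bounded, on a set of finite
measure, are the test functions of all the arguments below. *)
Lemma L2_wcomp_bounded (C : R) (n : nat) (D : set X) f : 0 <= C -> measurable D ->
  (mu D < +oo)%E -> (forall x, D x -> h x <= n%:R) ->
  cmeasurable f -> (forall x, normc2 (f x) <= C * \1_D x) ->
  L2 mu f /\ L2 mu (W f).
Proof.
move=> C0 mD Doo hn mf fC; split; first exact: L2_bounded fC.
split; first exact: cmeasurable_wcomp.
rewrite integral_normc2_wcomp//.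
apply: (@le_lt_trans _ _ (\int[mu]_x ((C * n%:R)%:E * (\1_D x)%:E))%E).
  apply: ge0_le_integral => //.
  - by move=> x _; rewrite lee_fin mulr_ge0// normc2_ge0.
  - apply/measurable_EFinP; apply: measurable_funM => //.
    exact: measurable_normc2.
  - apply/measurable_EFinP; apply: measurable_funM => //.
  - move=> x _; rewrite -EFinM lee_fin; have := fC x.
    rewrite !indicE; case: (boolP (x \in D)) => [/set_mem xD|_] /=.
      rewrite !mulr1 => fx; apply: ler_pM => //; last exact: hn.
      exact: normc2_ge0.
    rewrite !mulr0 => fx; have -> : normc2 (f x) = 0.
      by apply/eqP; rewrite eq_le fx normc2_ge0.
    by rewrite mul0r.
rewrite integralZl//; last first.
  apply/integrableP; split.
    by apply/measurable_EFinP; exact: measurable_indic.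
  under eq_integral do rewrite gee0_abs ?lee_fin//.
  by rewrite integral_indic// setIT.
rewrite integral_indic// setIT.
by rewrite lte_mul_pinfty// lee_fin mulr_ge0.
Qed.

Lemma wcomp_ae f g : {ae mu, forall x, h x != 0 -> f x = g x} ->
  ae_eq2 mu (W f) (W g).
Proof.
move=> /(ae_transfer T); apply: filterS => x fg; rewrite /wcomp.
by have [->|wx] := eqVneq (w x) 0; [rewrite !mul0r|rewrite fg ?w0P].
Qed.

Lemma wcomp_ae_inv f g : cmeasurable f -> cmeasurable g ->
  ae_eq2 mu (W f) (W g) -> {ae mu, forall x, h x != 0 -> f x = g x}.
Proof.
move=> mf mg H; apply: (ae_transfer_inv T).
  have /measurableC := measurable_neq0c (cmeasurableB mf mg).
  congr measurable; apply/seteqP; split => x /=.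
    by move/negP; rewrite negbK subr_eq0 => /eqP.
  by move=> ->; rewrite subrr eqxx.
apply: filterS H => x H; rewrite w0P => wx; exact: (mulfI wx) H.
Qed.

Lemma wco_is_operator : is_operator mu Cw.
Proof.
split.
- by move=> f g [].
- move=> f g f' g' [/= Lf Lg LW gW] Lf' Lg' ff' gg'.
  have WW : ae_eq2 mu (W f) (W f').
    by apply: wcomp_ae; apply: filterS ff' => x ->.
  have mWf' : cmeasurable (W f') by apply: cmeasurable_wcomp; case: Lf'.
  split => //=; first exact: L2_ae WW.
  by apply: filterS3 gW gg' WW => x; rewrite /wcomp => -> <- ->.
- move=> f g g' [/= _ _ _ H] [/= _ _ _ H'].
  by apply: filterS2 H H' => x -> ->.
- split => /=; [exact: L2_0|exact: L2_0| |].
    rewrite (_ : (fun x => _) = cst 0); first exact: L2_0.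
    by apply/funext => x; rewrite mulr0.
  by apply: aeW => x; rewrite mulr0.
- move=> a f g f' g' [/= Lf Lg LW gW] [/= Lf' Lg' LW' gW'].
  split => /=; [exact: L2_lin|exact: L2_lin| |].
    by have := L2_lin a LW LW'; rewrite -(wcomp_lin a f f').
  by apply: filterS2 gW gW' => x -> ->; ring.
Qed.

Lemma dom_wcoP k : dom Cw k <-> L2 mu k /\ L2 mu (W k).
Proof.
split; first by move=> [g []].
by move=> [Lk LWk]; exists (W k); split => //=; exact: aeW.
Qed.

Lemma ker_wcoP f : ker Cw f <->
  L2 mu f /\ {ae mu, forall x, h x != 0 -> f x = 0}.
Proof.
have W0 : W (cst 0) = cst 0 by apply/funext => x; rewrite /wcomp mulr0.
split.
  move=> [/= Lf _ _ H]; split => //; apply: (wcomp_ae_inv (g := cst 0)).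
  - by case: Lf.
  - exact: cmeasurable_cst.
  - by rewrite W0; apply: filterS H => x /= /esym.
move=> [Lf H]; have := wcomp_ae (g := cst 0) H; rewrite W0 => Wf.
split => //=; first exact: L2_0.
  apply: (L2_ae (L2_0 _)); first by apply: cmeasurable_wcomp; case: Lf.
  by apply: filterS Wf => x /= /esym.
by apply: filterS Wf => x /= /esym.
Qed.

Let Z : set X := [set x | h x = 0].
Let mZ : measurable Z. Proof. exact: measurable_eq0. Qed.

Lemma orth_ker_wcoP s : orth mu (ker Cw) s <->
  L2 mu s /\ {ae mu, forall x, h x = 0 -> s x = 0}.
Proof.
split.
  move=> [Ls H]; split => //.
  have kZ : ker Cw (crestrict Z s).
    apply/ker_wcoP; split; first exact: L2_crestrict.
    apply: aeW => x hx; rewrite /crestrict indicE memNset ?mul0r//.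
    exact/eqP.
  have : inner mu (crestrict Z s) (crestrict Z s) = 0.
    rewrite -[RHS](H _ kZ); apply: inner_eq_pointwise => x.
    rewrite /crestrict indicE; case: (x \in Z).
      by rewrite !mul1r.
    by rewrite !mul0r rmorph0 !mulr0.
  move/(inner_eq0 (L2_crestrict mZ Ls)); apply: filterS => x + hx.
  by rewrite /crestrict indicE mem_set// mul1r.
move=> [Ls H]; split => // g /ker_wcoP[Lg Hg].
rewrite -(inner0l Lg); apply: inner_eq_ae.
- by case: Ls.
- by case: Lg.
- exact: cmeasurable_cst.
- by case: Lg.
- apply: filterS2 H Hg => x /= H Hg.
  have [hx|hx] := eqVneq (h x) 0; first by rewrite H.
  by rewrite Hg// rmorph0 !mulr0.
Qed.

(** Cutting [f] into its parts on [{h = 0}] and off it does not change [W f], so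
both parts stay in the domain. *)
Lemma wco_decomposition :
  dom Cw = sum_set (ker Cw) (dom Cw `&` orth mu (ker Cw)).
Proof.
apply/seteqP; split => f.
  move=> /dom_wcoP[Lf LWf].
  have mf : cmeasurable f by case: Lf.
  have mZC : measurable (~` Z) by exact: measurableC.
  exists (crestrict Z f), (crestrict (~` Z) f); split.
  - apply/ker_wcoP; split; first exact: L2_crestrict.
    apply: aeW => x hx; rewrite /crestrict indicE memNset ?mul0r//.
    exact/eqP.
  - split.
      apply/dom_wcoP; split; first exact: L2_crestrict.
      apply: (L2_ae LWf); first exact/cmeasurable_wcomp/cmeasurable_crestrict.
      apply: wcomp_ae; apply: aeW => x hx.
      by rewrite /crestrict indicE mem_set ?mul1r//; exact/eqP.
    apply/orth_ker_wcoP; split; first exact: L2_crestrict.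
    apply: aeW => x hx; rewrite /crestrict indicE memNset ?mul0r//.
  - apply/funext => x; rewrite /crestrict /= !indicE in_setC.
    by case: (x \in Z); rewrite /= ?mul1r ?mul0r ?addr0 ?add0r.
move=> [a [b [/= ka [db _] ->]]].
have [g Tbg] := db; exists g.
have := op_lin wco_is_operator 1 ka Tbg.
by congr (Cw (_, _)); apply/funext => x /=; rewrite ?mul1r ?mulr0 ?add0r.
Qed.

(** [W s] is the orthogonal projection of [f] on the closure of the range; the
values of [s] on [{h = 0}], which [W s] does not see, are fixed to be 0. *)
Definition wproj f s :=
  [/\ L2 mu f, cmeasurable s, L2 mu (W s),
      {ae mu, forall x, h x = 0 -> s x = 0} & orth mu (ran Cw) (f \- W s)].

Lemma reciprocal_wcoP f s : reciprocal mu Cw (f, s) <-> L2 mu s /\ wproj f s.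
Proof.
have TO := wco_is_operator.
rewrite (is_reciprocal_graph _ _ TO (reciprocalP TO wco_decomposition)).
have rL : ran Cw `<=` L2 mu by move=> g [e /(op_L2 TO)[]].
split.
  move=> [Lf /orth_ker_wcoP[Ls sZ] [q [/= _ Lq LW qW] fq]]; split => //.
  split => //; first by case: Ls.
  apply: (orth_ae rL fq); first exact: L2_sub.
  by apply: filterS qW => x /= ->.
move=> [Ls [Lf ms LW sZ fW]]; split => //; first by apply/orth_ker_wcoP.
by exists (W s) => //; split => //=; exact: aeW.
Qed.

Lemma wproj_test f s k : wproj f s -> L2 mu k -> L2 mu (W k) ->
  inner mu f (W k) = inner mu (W s) (W k).
Proof.
move=> [Lf ms LW _ [_ H]] Lk LWk; apply/eqP; rewrite -subr_eq0 -innerB//.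
by apply/eqP/H; exists k; split => //=; exact: aeW.
Qed.

Lemma inner_wcomp s k : cmeasurable s -> cmeasurable k ->
  inner mu (W s) (W k) =
  cintegral mu setT (fun x => s x * (k x)^*%C * (h x)%:C%C).
Proof.
move=> ms mk.
rewrite -(cintegral_transfer T (g := fun x => s x * (k x)^*%C)); last first.
  by apply: cmeasurableM => //; exact: cmeasurable_conj.
rewrite /inner; congr cintegral; apply/funext => x.
by rewrite /wcomp -mul_conjc rmorphM/=; ring.
Qed.

Lemma wproj_intro f s : L2 mu f -> cmeasurable s -> L2 mu (W s) ->
  {ae mu, forall x, h x = 0 -> s x = 0} ->
  (forall k, L2 mu k -> L2 mu (W k) -> inner mu f (W k) = inner mu (W s) (W k)) ->
  wproj f s.
Proof.
move=> Lf ms LW sZ H; split => //; split; first exact: L2_sub.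
move=> g [k [/= Lk Lg LWk gW]].
transitivity (inner mu (f \- W s) (W k)); last first.
  by rewrite innerB// H// subrr.
have mfW : cmeasurable (f \- W s) by case: (L2_sub Lf LW).
apply: inner_eq_ae => //; [by case: Lg|by case: LWk|].
by apply: filterS gW => x ->.
Qed.

Lemma wproj_ae f s s' : wproj f s -> cmeasurable s' -> ae_eq2 mu s s' ->
  wproj f s'.
Proof.
move=> P ms' ss'; have [Lf ms LW sZ _] := P.
have WW : ae_eq2 mu (W s) (W s').
  by apply: wcomp_ae; apply: filterS ss' => x ->.
have LW' : L2 mu (W s') by apply: (L2_ae LW) => //; exact: cmeasurable_wcomp.
apply: wproj_intro => //; first by apply: filterS2 ss' sZ => x <-.
move=> k Lk LWk; rewrite (wproj_test P)//.
exact: inner_ae.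
Qed.

Lemma wproj_lin a f s f' s' : wproj f s -> wproj f' s' ->
  wproj (fun x => a * f x + f' x) (fun x => a * s x + s' x).
Proof.
move=> P P'; have [Lf ms LW sZ _] := P; have [Lf' ms' LW' sZ' _] := P'.
apply: wproj_intro.
- exact: L2_lin.
- exact: cmeasurable_lin.
- by rewrite wcomp_lin; exact: L2_lin.
- by apply: filterS2 sZ sZ' => x sZ sZ' hx; rewrite sZ// sZ'// mulr0 addr0.
- move=> k Lk LWk; rewrite wcomp_lin !inner_lin//.
  by rewrite (wproj_test P)// (wproj_test P').
Qed.

(** Orthogonality to the range extends to [W k] for [k] outside [L^2]: the
truncations of [k] lie in the domain, and dominated convergence applies. *)
Lemma wproj_test_ext f s k : wproj f s -> cmeasurable k -> L2 mu (W k) ->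
  inner mu f (W k) = inner mu (W s) (W k).
Proof.
move=> P mk LWk; have [Lf ms LW sZ [_ _]] := P.
apply/eqP; rewrite -subr_eq0 -innerB//; apply/eqP.
have [E [mE Eoo ndE ET En]] := le_exhaustion mu (measurable_normc2 mk).
have LfW := L2_sub Lf LW.
apply: (@cintegral_exhaust0 _ _ _ _ _ (fun n => phi @^-1` E n)).
- exact: cintegrable_prod.
- by move=> n; rewrite -[X in measurable X]setTI; exact: mphi.
- move=> m n mn; apply/subsetPset => x /=.
  by move/subsetPset: (ndE _ _ mn); exact.
- by rewrite -preimage_bigcup ET.
- move=> n; pose k' := crestrict (E n) k.
  have Lk' : L2 mu k'.
    apply: (L2_bounded (C := n%:R) (mE n) (Eoo n) (cmeasurable_crestrict (mE n) mk)).
    move=> x; rewrite normc2_crestrict indicE.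
    case: (boolP (x \in E n)) => [/set_mem/En kx|_].
      by rewrite mul1r mulr1.
    by rewrite mul0r mulr0.
  have Wk'E : W k' = crestrict (phi @^-1` E n) (W k).
    by apply/funext => x; rewrite /W /k' /crestrict !indicE /wcomp mulrCA.
  have LWk' : L2 mu (W k').
    rewrite Wk'E; apply: L2_crestrict => //.
    by rewrite -[X in measurable X]setTI; exact: mphi.
  have := wproj_test P Lk' LWk'.
  move/eqP; rewrite -subr_eq0 -innerB// Wk'E => /eqP <-.
  congr cintegral; apply/funext => x; rewrite /crestrict [in RHS]rmorphM.
  by rewrite /= oppr0 mulrCA.
Qed.

End weighted_composition.

(** * Existence of the projection on the range *)

Section existence.
Context {d} {X : measurableType d} {R : realType}.
Variable mu : {sigma_finite_measure set X -> \bar R}.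
Variables (phi : X -> X) (w : X -> R[i]) (h : X -> R).
Hypotheses (mw : cmeasurable w)
  (T : transfers mu phi (fun x => normc2 (w x)) h).
Implicit Types f g k s : X -> R[i].

Local Notation W := (wcomp phi w).
Local Notation wproj := (wproj mu phi w h).

Let mphi : measurable_fun setT phi. Proof. by case: T. Qed.
Let mh : measurable_fun setT h. Proof. by case: T => ? ? []. Qed.
Let h0 x : 0 <= h x. Proof. by case: T => ? ? []. Qed.
Let mphiE A : measurable A -> measurable (phi @^-1` A).
Proof. by move=> mA; rewrite -[X in measurable X]setTI; exact: mphi. Qed.

Lemma L2_weight_bounded n D : measurable D -> (mu D < +oo)%E ->
  (forall x, D x -> h x <= n%:R) -> L2 mu (crestrict (phi @^-1` D) w).
Proof.
move=> mD Doo hn; rewrite -wcomp_indic.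
apply: (proj2 (L2_wcomp_bounded mw T (C := 1) (n := n) ler01 mD Doo hn _ _)).
  by apply: cmeasurable_real; exact: measurable_indic.
move=> x; rewrite normc2_real mul1r indicE.
by case: (_ \in _); rewrite ?expr1n ?expr0n.
Qed.

(** The image under [phi] of the measure of density [|w|^2 r] is absolutely
continuous because that of [|w|^2 mu] is. On a set of finite measure where [h]
is bounded it is finite, as [|w|^2 r] is the product of [w r] and [w], both
square integrable over the preimage. So it has a density. *)
Lemma weighted_density_exists (r : X -> R) : measurable_fun setT r ->
  (forall x, 0 <= r x) -> L2 mu (fun x => w x * (r x)%:C%C) ->
  exists H, transfers mu phi (fun x => normc2 (w x) * r x) H.
Proof.
move=> mr r0 Lwr; pose rho x := normc2 (w x) * r x.
have mrho : measurable_fun setT rho.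
  by apply: measurable_funM => //; exact: measurable_normc2.
have rho0 x : 0 <= rho x by rewrite mulr_ge0// normc2_ge0.
have merho : measurable_fun setT (EFin \o rho) by exact/measurable_EFinP.
have erho0 x : (0 <= (EFin \o rho) x)%E by rewrite lee_fin.
have [nu nuE] := image_measure_exists
  (density_measure mu merho erho0 : {measure set X -> \bar R}) mphi.
have {}nuE D : nu D = (\int[mu]_(x in phi @^-1` D) (rho x)%:E)%E by rewrite nuE.
have [E [mE Eoo ndE ET En]] := le_exhaustion mu mh.
have numu : nu `<< mu.
  apply/null_content_dominatesP => D mD D0; rewrite nuE.
  transitivity (\int[mu]_(x in phi @^-1` D) (cst 0%E) x)%E; last first.
    by rewrite integral0.
  apply: ae_eq_integral => //.
  - exact: mphiE.
  - exact: measurable_funTS.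
  - have : {ae mu, forall x, h x != 0 -> ~ D x}.
      by exists D; split => // x /= /not_implyP[_ /contrapT].
    move/(ae_transfer T); apply: filterS => x H Dx.
    have [w0|w0] := eqVneq (normc2 (w x)) 0; first by rewrite /= /rho w0 mul0r.
    by case: (H w0).
have nuE_lty n : measurable (E n) /\ (nu (E n) < +oo)%E.
  split => //; have LE := L2_weight_bounded (mE n) (Eoo n) (En n).
  have [/integrableP[_ +] _] := cintegrable_prod Lwr LE.
  apply: le_lt_trans; rewrite nuE [leLHS]integral_mkcond.
  rewrite le_eqVlt; apply/orP; left; apply/eqP; apply: eq_integral => x _.
  rewrite patchE /crestrict indicE; case: (_ \in _); last first.
    by rewrite mul0r rmorph0 mulr0 abse_EFin normr0.
  by rewrite mul1r mulrAC mul_conjc -rmorphM/= ger0_norm ?rho0.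
have [H [mH H0 HE]] := density_exists numu nuE_lty ET.
by exists H; split => // D mD; rewrite -HE// nuE.
Qed.

(** For [r >= 0] the symbol is [s = H / h], where [H] is the density of the
image of the measure of density [|w|^2 r]: [w r] and [W s] then have the same
inner product with every [W k]. Square integrability of [W s] follows from
Bessel's inequality applied to the truncations of [s]. *)
Lemma wproj_exists_ge0 (r : X -> R) : measurable_fun setT r ->
  (forall x, 0 <= r x) -> L2 mu (fun x => w x * (r x)%:C%C) ->
  exists s, wproj (fun x => w x * (r x)%:C%C) s.
Proof.
move=> mr r0 Lf; set f := fun x => _ in Lf *.
have [H TH] := weighted_density_exists mr r0 Lf.
have mH : measurable_fun setT H by case: TH => ? ? [].
have H0 x : 0 <= H x by case: TH => ? ? [].
pose s x := H x / h x.
have ms : measurable_fun setT s.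
  by apply: measurable_funM => //; exact: measurable_funV.
have s0 x : 0 <= s x by rewrite divr_ge0.
pose S x := (s x)%:C%C.
have mS : cmeasurable S by exact: cmeasurable_real.
(* Almost everywhere, [h o phi] vanishes only where [w] does, so that [H] is 0
   on [{h = 0}] as well. *)
have Hh : {ae mu, forall x, H x = s x * h x}.
  have : {ae mu, forall x, H x != 0 -> h x != 0}.
    apply: (ae_transfer_inv TH (P := fun x => h x != 0)).
      exact: measurable_neq0.
    apply: filterS (ae_transfer_neq0 T) => x hx.
    by rewrite mulf_eq0 negb_or => /andP[/hx].
  apply: filterS => x; rewrite /s; have [-> _|Hx /(_ isT) hx] := eqVneq (H x) 0.
    by rewrite !mul0r.
  by rewrite divfK.
have mwr k : cmeasurable k -> inner mu f (W k) = inner mu (W S) (W k).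
  move=> mk; rewrite (inner_wcomp T)//.
  transitivity (cintegral mu setT
      (fun x => (k (phi x))^*%C * (normc2 (w x) * r x)%:C%C)).
    rewrite /inner; congr cintegral; apply/funext => x.
    by rewrite /f /wcomp !rmorphM/= -mul_conjc; ring.
  have mck := cmeasurable_conj mk.
  rewrite (cintegral_transfer TH (g := fun x => (k x)^*%C))//.
  apply: cintegral_ae.
  - by apply: cmeasurableM => //; exact: cmeasurable_real.
  - by apply: cmeasurableM; [exact: cmeasurableM|exact: cmeasurable_real].
  - by apply: filterS Hh => x ->; rewrite /S rmorphM/=; ring.
have [D [mD Doo ndD DT Dn]] := le_exhaustion mu (measurable_funD mh ms).
have LS : L2 mu (W S).
  apply: (@L2_exhaust _ _ _ mu (\int[mu]_x (normc2 (f x))%:E)%E _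
      (fun n => phi @^-1` D n)).
  - exact: (cmeasurable_wcomp mw T mS).
  - by case: Lf.
  - by move=> n; exact: mphiE.
  - move=> m n mn; apply/subsetPset => x /=.
    by move/subsetPset: (ndD _ _ mn); exact.
  - by rewrite -preimage_bigcup DT.
  - move=> n; rewrite -wcomp_crestrict.
    have mk : cmeasurable (crestrict (D n) S) by exact: cmeasurable_crestrict.
    have kD x : normc2 (crestrict (D n) S x) <= n%:R ^+ 2 * \1_(D n) x.
      rewrite normc2_crestrict normc2_real mulrC indicE.
      case: (boolP (x \in D n)) => [/set_mem/Dn xD|]; last by rewrite !mulr0.
      rewrite !mulr1 lerXn2r// ?nnegrE//.
      by apply: le_trans xD; rewrite lerDr.
    have Dh x : D n x -> h x <= n%:R by move=> /Dn; apply: le_trans; rewrite lerDl.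
    have n2 : 0 <= (n%:R ^+ 2 : R) by rewrite exprn_ge0.
    have [_ LWk] := L2_wcomp_bounded mw T n2 (mD n) (Doo n) Dh mk kD.
    apply: bessel => //; rewrite mwr// !(inner_wcomp T)//.
    congr cintegral; apply/funext => x; rewrite /crestrict.
    rewrite indicE; case: (_ \in _); first by rewrite !mul1r.
    by rewrite !mul0r rmorph0 mulr0 mul0r.
exists S; apply: wproj_intro => //.
  by apply: aeW => x hx; rewrite /S /s hx invr0 mulr0.
by move=> k [mk _] _; exact: mwr.
Qed.

(** [f] and [w f_w] have the same inner products with the range, and [f_w] is a
combination of four nonnegative functions. *)
Lemma wproj_exists f : L2 mu f -> exists s, wproj f s.
Proof.
move=> Lf; have mf : cmeasurable f by case: Lf.
pose u := cweight_div w f.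
have mu' : cmeasurable u by exact: cmeasurable_cweight_div.
have wu x : normc2 (w x * u x) <= normc2 (f x).
  rewrite /u /cweight_div; case: eqP => [_|/eqP wx].
    by rewrite mulr0 normc2_0 normc2_ge0.
  by rewrite mulrC divfK.
have [mu1 mu2] := mu'.
have part (r : X -> R) : measurable_fun setT r -> (forall x, 0 <= r x) ->
    (forall x, r x ^+ 2 <= normc2 (u x)) ->
    exists s, wproj (fun x => w x * (r x)%:C%C) s.
  move=> mr r0 ru; apply: wproj_exists_ge0 => //.
  apply: (@L2_le _ _ _ mu 1 _ f) => //.
    by apply: cmeasurableM => //; exact: cmeasurable_real.
  move=> x; rewrite mul1r normc2M normc2_real; apply: le_trans (wu x).
  by rewrite normc2M ler_wpM2l// normc2_ge0.
have maxsq (a b : R) : Num.max a 0 ^+ 2 <= a ^+ 2 + b ^+ 2.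
  have [a0|a0] := leP a 0; last by rewrite lerDl sqr_ge0.
  by rewrite expr0n/= addr_ge0// sqr_ge0.
have max0 (a : R) : 0 <= Num.max a 0 by rewrite le_max lexx orbT.
have m0 : measurable_fun setT (cst 0 : X -> R) by exact: measurable_cst.
have [s1 P1] : exists s, wproj (fun x => w x * (Num.max (Re (u x)) 0)%:C%C) s.
  apply: part => // x; last exact: maxsq.
  exact: measurable_maxr.
have [s2 P2] : exists s, wproj (fun x => w x * (Num.max (- Re (u x)) 0)%:C%C) s.
  apply: part => // x; last by apply: le_trans (maxsq _ (Im (u x))) _; rewrite sqrrN.
  by apply: measurable_maxr => //; exact: measurable_funN.
have [s3 P3] : exists s, wproj (fun x => w x * (Num.max (Im (u x)) 0)%:C%C) s.
  apply: part => // x; first exact: measurable_maxr.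
  by apply: le_trans (maxsq _ (Re (u x))) _; rewrite addrC.
have [s4 P4] : exists s, wproj (fun x => w x * (Num.max (- Im (u x)) 0)%:C%C) s.
  apply: part => // x; first by apply: measurable_maxr => //; exact: measurable_funN.
  by apply: le_trans (maxsq _ (Re (u x))) _; rewrite sqrrN addrC.
(* [u] is the first part minus the second plus i times the third minus the
   fourth. *)
have P := wproj_lin (-1) P2 (wproj_lin (-'i)%C P4
  (wproj_lin 'i%C P3 P1)).
set F := fun x => _ in P; set s := fun x => _ in P.
have FE : F = fun x => w x * u x.
  apply/funext => x; rewrite /F.
  have maxE (a : R) : Num.max a 0 - Num.max (- a) 0 = a.
    have [a0|a0] := leP a 0.
      by rewrite (max_idPl _) ?oppr_ge0// sub0r opprK.
    by rewrite (max_idPr _) ?subr0// oppr_le0 ltW.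
  transitivity (w x * ((Num.max (Re (u x)) 0 - Num.max (- Re (u x)) 0)%:C%C +
     'i%C * (Num.max (Im (u x)) 0 - Num.max (- Im (u x)) 0)%:C%C)).
    have comb (a b c e z i : R[i]) :
      (-1) * (z * b) + (- i * (z * e) + (i * (z * c) + z * a)) =
      z * ((a - b) + i * (c - e)) by ring.
    by rewrite !rmorphB; exact: comb.
  rewrite !maxE; congr (_ * _); apply: complex_eqP => /=;
  by rewrite ?mulr0 ?mul0r ?mul1r ?subr0 ?addr0 ?add0r.
rewrite {}FE in P; exists s; have [LF ms LW sZ _] := P.
apply: wproj_intro => // k Lk LWk; rewrite -(wproj_test P)//.
apply: inner_eq_pointwise => x; rewrite /u /cweight_div /wcomp.
case: eqP => [->|/eqP wx]; first by rewrite mul0r rmorph0 !mulr0.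
by rewrite [w x * (f x / w x)]mulrC divfK.
Qed.

End existence.

(** * Symbols of projections as conditional expectations *)

Section conditional_expectation.
Context {d} {X : measurableType d} {R : realType}.
Variable mu : {sigma_finite_measure set X -> \bar R}.
Variables (phi : X -> X) (w : X -> R[i]) (h : X -> R) (eh : X -> \bar R).
Hypotheses (mw : cmeasurable w)
  (T : transfers mu phi (fun x => normc2 (w x)) h)
  (hE : {ae mu, forall x, eh x = (h x)%:E}).
Implicit Types f g k s : X -> R[i].

Local Notation W := (wcomp phi w).
Local Notation wproj := (wproj mu phi w h).
Local Notation muw := (mu_w mu w).

Let mphi : measurable_fun setT phi. Proof. by case: T. Qed.
Let mh : measurable_fun setT h. Proof. by case: T => ? ? []. Qed.
Let h0 x : 0 <= h x. Proof. by case: T => ? ? []. Qed.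
Let mphiE A : measurable A -> measurable (phi @^-1` A).
Proof. by move=> mA; rewrite -[X in measurable X]setTI; exact: mphi. Qed.
Let mw2 : measurable_fun setT (fun x => normc2 (w x)).
Proof. exact: measurable_normc2. Qed.
Let w20 x : 0 <= normc2 (w x). Proof. exact: normc2_ge0. Qed.

Lemma cintegral_mu_w A g : measurable A -> cmeasurable g ->
  cintegral muw A g = inner mu (fun x => w x * g x) (crestrict A w).
Proof.
move=> mA [g1 g2]; rewrite /inner /cintegral.
congr (fine _ +i* fine _)%C.
  rewrite (integral_density mu mw2 w20 mA g1) integral_mkcond.
  apply: eq_integral => x _; rewrite patchE /crestrict indicE.
  case: (_ \in _); last by rewrite mul0r rmorph0 mulr0.
  by rewrite mul1r mulrAC mul_conjc /=; case: (g x) => a b /=; rewrite mul0r subr0 mulrC.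
rewrite (integral_density mu mw2 w20 mA g2) integral_mkcond.
apply: eq_integral => x _; rewrite patchE /crestrict indicE.
case: (_ \in _); last by rewrite mul0r rmorph0 mulr0.
by rewrite mul1r mulrAC mul_conjc /=; case: (g x) => a b /=; rewrite mul0r addr0 mulrC.
Qed.

Lemma cintegrable_mu_w A g : measurable A -> cmeasurable g ->
  cintegrable muw A g <->
  cintegrable mu setT (fun x => w x * g x * (crestrict A w x)^*%C).
Proof.
move=> mA [g1 g2]; rewrite /cintegrable.
rewrite (integrable_density mu mw2 w20 mA g1) (integrable_density mu mw2 w20 mA g2).
rewrite !(integrable_mkcond _ mA).
rewrite [X in integrable _ _ X /\ _ <-> _](_ : _ = fun x =>
  (Re (w x * g x * (crestrict A w x)^*%C))%:E); last first.
  apply/funext => x; rewrite patchE /crestrict indicE.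
  case: (_ \in _); last by rewrite mul0r rmorph0 mulr0.
  by rewrite mul1r mulrAC mul_conjc /=; case: (g x) => a b /=; rewrite mul0r subr0 mulrC.
rewrite [X in _ /\ integrable _ _ X <-> _](_ : _ = fun x =>
  (Im (w x * g x * (crestrict A w x)^*%C))%:E)//.
apply/funext => x; rewrite patchE /crestrict indicE.
case: (_ \in _); last by rewrite mul0r rmorph0 mulr0.
by rewrite mul1r mulrAC mul_conjc /=; case: (g x) => a b /=; rewrite mul0r addr0 mulrC.
Qed.

Lemma mu_w_preimage D : measurable D ->
  muw (phi @^-1` D) = (\int[mu]_(x in D) (h x)%:E)%E.
Proof. by case: T => _ _ _; exact. Qed.

Lemma L2_weight_preimage D : measurable D -> (muw (phi @^-1` D) < +oo)%E ->
  L2 mu (crestrict (phi @^-1` D) w).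
Proof.
move=> mD Doo; split; first exact/cmeasurable_crestrict/mw/mphiE.
apply: le_lt_trans Doo; rewrite /mu_w /density [leRHS]integral_mkcond.
rewrite le_eqVlt; apply/orP; left; apply/eqP; apply: eq_integral => x _.
by rewrite normc2_crestrict patchE indicE; case: (_ \in _); rewrite ?mul1r ?mul0r.
Qed.

Lemma ae_mu_w (P : X -> Prop) : {ae muw, forall x, P x} ->
  {ae mu, forall x, w x != 0 -> P x}.
Proof.
move=> [N [mN N0 NP]].
have : (\int[mu]_(x in N) `|(normc2 (w x))%:E| = 0)%E.
  by under eq_integral do rewrite gee0_abs ?lee_fin//.
move/ae_eq_integral_abs => -[//||N' [mN' N'0 N'P]].
  by apply/measurable_EFinP; exact: measurable_funTS.
exists N'; split => // x /= /not_implyP[wx nP]; apply: N'P => /= H.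
have Nx : N x by exact: NP.
by move/eqP: wx; apply; apply: normc2_eq0; apply: EFin_inj; exact: H.
Qed.

Lemma measurable_preimage_map :
  measurable_fun (setT : set (g_sigma_algebra_preimageType phi)) phi.
Proof. by move=> _ A mA; exists A. Qed.

Lemma cmeasurable_preimage (e : X -> R[i]) :
  @cmeasurable _ (g_sigma_algebra_preimageType phi) R e -> cmeasurable e.
Proof.
have sub A : measurable (A : set (g_sigma_algebra_preimageType phi)) ->
    measurable (A : set X).
  by move=> [B mB <-]; rewrite setTI; exact: mphiE.
move=> [e1 e2]; split => _ A mA; apply: sub; [exact: e1|exact: e2].
Qed.

(** Testing against [W 1_D], which is [w] cut to the preimage of [D], turns the
orthogonality relation into the defining property of the conditional
expectation. *)
Lemma wproj_condexp_inv f s : wproj f s ->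
  is_condexp_inv mu phi w eh (cweight_div w f) s.
Proof.
move=> P; have [Lf ms LW sZ _] := P; have mf : cmeasurable f by case: Lf.
split => //.
  by apply: filterS2 hE sZ => x -> sZ hx; apply: sZ; exact: EFin_inj.
exists (s \o phi); last by exists set0; split => //; [exact: integral_set0|move=> x /=; case].
split; first exact: cmeasurable_comp measurable_preimage_map ms.
move=> D mD Doo; have LD := L2_weight_preimage mD Doo.
have msp : cmeasurable (s \o phi) by exact: cmeasurable_comp.
have mpD := mphiE mD.
split; first by apply/cintegrable_mu_w => //; exact: cintegrable_prod.
rewrite !cintegral_mu_w//; last exact: cmeasurable_cweight_div.
rewrite -[LHS]/(inner mu (W s) _) -wcomp_indic.
rewrite -(wproj_test_ext T P); last 2 first.
- by apply: cmeasurable_real; exact: measurable_indic.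
- by rewrite wcomp_indic.
apply: inner_eq_pointwise => x; rewrite /wcomp /crestrict /cweight_div.
case: eqP => [->|/eqP wx]; first by rewrite !(mul0r, mulr0, rmorph0).
by rewrite [w x * (f x / w x)]mulrC divfK// [w x * _]mulrC.
Qed.

Lemma condexp_inv_test F s D : is_condexp_inv mu phi w eh F s ->
  measurable D -> (muw (phi @^-1` D) < +oo)%E ->
  cintegrable mu setT (crestrict D (fun x => s x * (h x)%:C%C)) /\
  cintegral mu setT (crestrict D (fun x => s x * (h x)%:C%C)) =
  cintegral muw (phi @^-1` D) F.
Proof.
move=> [ms sZ [e [/cmeasurable_preimage me eP] es]] mD Doo.
have [ie <-] := eP D mD Doo; have mpD := mphiE mD.
pose g := crestrict D s.
have mg : cmeasurable g by exact: cmeasurable_crestrict.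
have gE : crestrict D (fun x => s x * (h x)%:C%C) = fun x => g x * (h x)%:C%C.
  by apply/funext => x; rewrite /g /crestrict mulrA.
have mgp : cmeasurable (fun x => g (phi x) * (normc2 (w x))%:C%C).
  by apply: cmeasurableM; [exact: cmeasurable_comp mg|exact: cmeasurable_real].
have ae : {ae mu, forall x, w x * e x * (crestrict (phi @^-1` D) w x)^*%C =
    g (phi x) * (normc2 (w x))%:C%C}.
  apply: filterS (ae_mu_w es) => x; have [->|wx /(_ isT) ->] := eqVneq (w x) 0.
    by rewrite !mul0r normc2_0 mulr0.
  rewrite /g /crestrict !indicE -mul_conjc /=.
  have -> : (x \in phi @^-1` D) = (phi x \in D) by [].
  case: (_ \in D); rewrite ?mul1r ?mul0r ?rmorph0 ?mulr0//.
  by rewrite mulrA (mulrC (w x)).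
rewrite gE; split.
  apply/(cintegrable_transfer T mg); apply: cintegrable_ae mgp ae _.
  exact/cintegrable_mu_w.
rewrite -(cintegral_transfer T mg) cintegral_mu_w//.
apply: cintegral_ae => //; last by apply: filterS ae => x ->.
apply: cmeasurableM; first exact: cmeasurableM.
exact/cmeasurable_conj/cmeasurable_crestrict.
Qed.

(** On sets where [h] is bounded, [s h] is integrable and its integrals are
determined by [F]; this fixes [s] off [{h = 0}], where it vanishes. *)
Lemma condexp_inv_uniq F s s' : is_condexp_inv mu phi w eh F s ->
  is_condexp_inv mu phi w eh F s' -> ae_eq2 mu s s'.
Proof.
move=> H H'; have [ms sZ _] := H; have [ms' sZ' _] := H'.
have [E [mE Eoo ndE ET En]] := le_exhaustion mu mh.
have fin n A : measurable A -> A `<=` E n -> (muw (phi @^-1` A) < +oo)%E.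
  move=> mA AE; apply: (@le_lt_trans _ _ (\int[mu]_(x in E n) (n%:R)%:E)%E).
    rewrite mu_w_preimage//.
    apply: (@le_trans _ _ (\int[mu]_(x in E n) (h x)%:E)%E).
      apply: ge0_subset_integral => //.
      - by apply/measurable_EFinP; exact: measurable_funTS.
      - by move=> x _; rewrite lee_fin.
    apply: ge0_le_integral => //.
    - by move=> x _; rewrite lee_fin.
    - by apply/measurable_EFinP; exact: measurable_funTS.
    - by move=> x /En; rewrite lee_fin.
  rewrite integral_cst// lte_mul_pinfty// ?lee_fin//; exact: Eoo.
have mM s0 : cmeasurable s0 -> cmeasurable (fun x => s0 x * (h x)%:C%C).
  by move=> ms0; apply: cmeasurableM => //; exact: cmeasurable_real.
have : {ae mu, forall x n, E n x -> s x * (h x)%:C%C = s' x * (h x)%:C%C}.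
  apply/ae_foralln => n.
  have [i _] := condexp_inv_test H (mE n) (fin n _ (mE n) (@subset_refl _ _)).
  have [i' _] := condexp_inv_test H' (mE n) (fin n _ (mE n) (@subset_refl _ _)).
  apply: cintegral_ae_eq => //; [exact: mM|exact: mM|].
  move=> A mA AE; have [_ ->] := condexp_inv_test H mA (fin n _ mA AE).
  by have [_ ->] := condexp_inv_test H' mA (fin n _ mA AE).
move=> K; near=> x.
have sx : eh x = 0%E -> s x = 0 by near: x.
have sx' : eh x = 0%E -> s' x = 0 by near: x.
have hx : eh x = (h x)%:E by near: x; exact: hE.
have Kx : forall n, E n x -> s x * (h x)%:C%C = s' x * (h x)%:C%C by near: x; exact: K.
have [h00|h00] := eqVneq (h x) 0; first by rewrite sx ?sx' ?hx ?h00.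
have : setT x by []; rewrite -ET => -[n _ /Kx]; apply: mulIf.
by rewrite eq_complex /= eqxx andbT.
Unshelve. all: by end_near. Qed.

Lemma condexp_inv_wproj f s : L2 mu f ->
  is_condexp_inv mu phi w eh (cweight_div w f) s -> wproj f s.
Proof.
move=> Lf H; have [s0 P] := wproj_exists mw T Lf.
have [ms _ _] := H; apply: (wproj_ae mw T P ms).
exact: condexp_inv_uniq (wproj_condexp_inv P) H.
Qed.

End conditional_expectation.

(** * Finiteness of the Radon-Nikodym derivative *)

Section finite_derivative.
Context {d} {X : measurableType d} {R : realType}.
Variable mu : {sigma_finite_measure set X -> \bar R}.
Variables (phi : X -> X) (w : X -> R[i]) (eh : X -> \bar R).
Hypotheses (mphi : measurable_fun setT phi) (mw : cmeasurable w)
  (dw : dense_in_L2 mu (dom (wco mu phi w)))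
  (hE : is_RN mu phi w eh).

(** On a set where [f] is bounded away from 0 and [h_{phi,w}] is infinite, the
integral of [|f|^2 h_{phi,w}] is infinite unless the set is null. *)
Lemma dom_wco_infty f : dom (wco mu phi w) f ->
  {ae mu, forall x, eh x = +oo%E -> f x = 0}.
Proof.
have [meh eh0 RN] := hE.
move=> [g [/= Lf _ LW _]]; have [mf _] := Lf.
pose A n := [set x | eh x = +oo%E] `&` [set x | (normc2 (f x))^-1 <= n%:R]
   `&` [set x | f x != 0].
have mA n : measurable (A n).
  apply: measurableI; last exact: measurable_neq0c.
  apply: measurableI.
    rewrite -[X in measurable X]setTI; apply: (meh measurableT [set +oo%E]).
    exact: emeasurable_set1.
  apply: measurable_le_cst; apply: measurable_funV; first exact: measurable_normc2.
  by move=> x; exact: normc2_ge0.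
have A0 n : mu (A n) = 0%E.
  have : pushforward (mu_w mu w) phi (A n) = (+oo * mu (A n))%E.
    rewrite RN// -integral_cst//; apply: eq_integral => x.
    by rewrite inE => -[[]].
  have : (pushforward (mu_w mu w) phi (A n) < +oo)%E.
    case: LW => mW Woo; rewrite /pushforward /mu_w /density.
    have mpA : measurable (phi @^-1` A n).
      by rewrite -[X in measurable X]setTI; exact: mphi.
    have mn : measurable_fun setT (fun x => (normc2 (w x * f (phi x)))%:E).
      by apply/measurable_EFinP; exact: measurable_normc2.
    have mn' : measurable_fun setT
        (fun x => (n%:R%:E * (normc2 (w x * f (phi x)))%:E)%E).
      exact: measurable_funeM.
    (* [1 <= n |f|^2] on [A n]. *)
    apply: (@le_lt_trans _ _
      (n%:R%:E * \int[mu]_x (normc2 (w x * f (phi x)))%:E)%E); last first.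
      by rewrite lte_mul_pinfty// lee_fin.
    rewrite -ge0_integralZl//; last by move=> x _; rewrite lee_fin normc2_ge0.
    apply: (@le_trans _ _ (\int[mu]_(x in phi @^-1` A n)
        (n%:R%:E * (normc2 (w x * f (phi x)))%:E))%E); last first.
      apply: ge0_subset_integral => // x _.
      by rewrite -EFinM lee_fin mulr_ge0// normc2_ge0.
    apply: ge0_le_integral => //.
    - by move=> x _; rewrite lee_fin normc2_ge0.
    - apply/measurable_EFinP; apply: measurable_funTS.
      exact: measurable_normc2.
    - exact: measurable_funTS.
    - move=> x [[_ /= fn] f0]; rewrite -EFinM lee_fin normc2M mulrCA.
      rewrite ler_peMr ?normc2_ge0// -ler_pdivrMr ?div1r//.
      by rewrite lt0r normc2_neq0 f0 normc2_ge0.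
  move=> + E; rewrite E => {E}.
  have [//|mu0] := eqVneq (mu (A n)) 0%E.
  by rewrite gt0_mulye ?ltxx// lt0e mu0 measure_ge0.
have : {ae mu, forall x n, ~ A n x}.
  apply/ae_foralln => n; exists (A n); split; [exact: mA|exact: A0|by move=> x /= /contrapT].
apply: filterS => x nA ex; apply: contrapT => /eqP fx.
pose n := (Num.truncn `|(normc2 (f x))^-1|).+1.
apply: (nA n); split => //; split => //=.
by apply: le_trans (ler_norm _) _; exact/ltW/truncnS_gt.
Qed.

(** All functions in the domain vanish where [h_{phi,w}] is infinite, so no indicator of
a subset of positive finite measure can be approximated. *)
Lemma RN_finite : {ae mu, forall x, (eh x < +oo)%E}.
Proof.
have [meh eh0 RN] := hE.
have [E [mE Eoo ndE ET _]] := le_exhaustion mu (@measurable_cst _ _ X R setT 0).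
pose B n := [set x | eh x = +oo%E] `&` E n.
have mB n : measurable (B n).
  apply: measurableI => //.
  rewrite -[X in measurable X]setTI; apply: (meh measurableT [set +oo%E]).
  exact: emeasurable_set1.
suff B0 n : mu (B n) = 0%E.
  have : {ae mu, forall x n, ~ B n x}.
    apply/ae_foralln => n; exists (B n); split; [exact: mB|exact: B0|by move=> x /= /contrapT].
  apply: filterS => x nB; rewrite ltey; apply/eqP => ex.
  have : setT x by []; rewrite -ET => -[n _ Ex]; exact: (nB n).
have Boo : (mu (B n) < +oo)%E.
  by apply: le_lt_trans (Eoo n); rewrite le_measure ?inE//; exact: subIsetr.
have Bfin : mu (B n) \is a fin_num by rewrite ge0_fin_numE.
pose f x : R[i] := (\1_(B n) x)%:C%C.
have nf x : normc2 (f x) = \1_(B n) x.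
  rewrite normc2_real indicE.
  by case: (_ \in _); rewrite ?expr1n ?expr0n.
have Lf : L2 mu f.
  apply: (L2_bounded (C := 1) (mB n) Boo).
    by apply: cmeasurable_real; exact: measurable_indic.
  by move=> x; rewrite nf mul1r.
apply: contrapT => /eqP B0.
pose m := fine (mu (B n)).
(* No [g] in the domain is closer to the indicator than the square root of
   the measure of its support. *)
have m0 : 0 < m.
  by rewrite fine_gt0// lt0e B0 measure_ge0/=.
have [_ /(_ (Num.sqrt m))] := dw Lf; rewrite sqrtr_gt0 => /(_ m0)[g gd].
apply/negP; rewrite -leNgt /L2norm ler_wsqrtr//.
have Lg : L2 mu g by case: gd => ? [].
have Lfg := L2_sub Lf Lg.
have fin : (\int[mu]_x (normc2 ((f \- g) x))%:E)%E \is a fin_num.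
  by apply: integrable_fin_num => //; exact: L2_integrable.
rewrite -lee_fin fineK// fineK//.
rewrite -(setIT (B n)) -integral_indic//.
apply: ae_ge0_le_integral => //.
- by apply/measurable_EFinP; exact: measurable_indic.
- by move=> x _; rewrite lee_fin normc2_ge0.
- by apply/measurable_EFinP; apply: measurable_normc2; exact: (proj1 Lfg).
- apply: filterS (dom_wco_infty gd) => x gx _; rewrite lee_fin.
  rewrite [leLHS]indicE; case: (boolP (x \in B n)) => [|_]; last exact: normc2_ge0.
  move=> xB; have [ex _] := set_mem xB.
  by rewrite /= gx// subr0 nf indicE xB.
Qed.

Lemma RN_transfers : exists2 h : X -> R,
  transfers mu phi (fun x => normc2 (w x)) h &
  {ae mu, forall x, eh x = (h x)%:E}.
Proof.
have [meh eh0 RN] := hE.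
have H : {ae mu, forall x, eh x = (fine (eh x))%:E}.
  by apply: filterS RN_finite => x ex; rewrite fineK// ge0_fin_numE.
have mf : measurable_fun setT (fine \o eh) by exact: measurableT_comp.
exists (fine \o eh) => //; split => //.
- split; first exact: measurable_normc2.
  by move=> x; exact: normc2_ge0.
- by split => // x; exact: fine_ge0.
- move=> D mD; rewrite -[LHS]/(pushforward (mu_w mu w) phi D) RN//.
  apply: ae_eq_integral => //.
  + exact: measurable_funTS.
  + by apply/measurable_EFinP; exact: measurable_funTS.
  + by apply: filterS H => x.
Qed.

End finite_derivative.

(** * The weights [w] and 1 compared *)

Section two_weights.
Context {d} {X : measurableType d} {R : realType}.
Variable mu : {sigma_finite_measure set X -> \bar R}.
Variables (phi : X -> X) (w : X -> R[i]) (h g : X -> R).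
Hypotheses (mw : cmeasurable w)
  (Tw : transfers mu phi (fun x => normc2 (w x)) h)
  (T1 : transfers mu phi (fun x => normc2 (cst 1 x : R[i])) g).
Implicit Types f k s u : X -> R[i].

Local Notation W := (wcomp phi w).
Local Notation W1 := (wcomp phi (cst 1)).
Local Notation wproj_w := (wproj mu phi w h).
Local Notation wproj_1 := (wproj mu phi (cst 1) g).

Let mphi : measurable_fun setT phi. Proof. by case: Tw. Qed.
Let mh : measurable_fun setT h. Proof. by case: Tw => ? ? []. Qed.
Let h0 x : 0 <= h x. Proof. by case: Tw => ? ? []. Qed.
Let mg : measurable_fun setT g. Proof. by case: T1 => ? ? []. Qed.
Let g0 x : 0 <= g x. Proof. by case: T1 => ? ? []. Qed.
Let mphiE A : measurable A -> measurable (phi @^-1` A).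
Proof. by move=> mA; rewrite -[X in measurable X]setTI; exact: mphi. Qed.
Let m1 : cmeasurable (cst 1 : X -> R[i]). Proof. exact: cmeasurable_cst. Qed.
Let mgh : measurable_fun setT (fun x => g x / h x).
Proof. by apply: measurable_funM => //; exact: measurable_funV. Qed.
Let gh0 x : 0 <= g x / h x. Proof. by rewrite divr_ge0. Qed.

Lemma ae_g_phi_neq0 : {ae mu, forall x, g (phi x) != 0}.
Proof.
apply: filterS (ae_transfer_neq0 T1) => x; apply.
by rewrite normc2_1 oner_eq0.
Qed.

Lemma ae_h_phi_neq0 : {ae mu, forall x, w x != 0 -> h (phi x) != 0}.
Proof. by apply: filterS (ae_transfer_neq0 Tw) => x; rewrite normc2_neq0. Qed.

Lemma ae_h_neq0 : {ae mu, forall x, h x != 0 -> g x != 0}.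
Proof.
apply: (ae_transfer_inv Tw (P := fun x => g x != 0)).
  exact: measurable_neq0.
by apply: filterS ae_g_phi_neq0.
Qed.

Lemma wproj_left_ae f f' s : wproj_1 f s -> L2 mu f' -> ae_eq2 mu f f' ->
  wproj_1 f' s.
Proof.
move=> P Lf' ff'; have [Lf ms LW sZ _] := P.
apply: wproj_intro => // k Lk LWk.
by rewrite -(inner_ae ff')// (wproj_test P).
Qed.

(** If [f] vanishes off the preimage of [A], so does its projection, since
cutting the test functions to [A] changes nothing. *)
Lemma wproj_crestrict f s A : wproj_w f s -> measurable A ->
  (forall x, f x != 0 -> A (phi x)) -> wproj_w f (crestrict A s).
Proof.
move=> P mA fA; have [Lf ms LW sZ _] := P; have mpA := mphiE mA.
apply: wproj_intro => //.
- exact: cmeasurable_crestrict.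
- by rewrite wcomp_crestrict; exact: L2_crestrict.
- by apply: filterS sZ => x sZ hx; rewrite /crestrict sZ// mulr0.
- move=> k Lk LWk.
  have LA : L2 mu (W (crestrict A k)).
    by rewrite wcomp_crestrict; exact: L2_crestrict.
  transitivity (inner mu f (W (crestrict A k))).
    apply: inner_eq_pointwise => x; have [->|fx] := eqVneq (f x) 0.
      by rewrite !mul0r.
    by rewrite wcomp_crestrict /crestrict indicE mem_set ?mul1r//; exact: fA.
  rewrite (wproj_test P)//; last exact: L2_crestrict.
  apply: inner_eq_pointwise => x; rewrite !wcomp_crestrict /crestrict indicE.
  by case: (_ \in _); rewrite ?mul1r ?mul0r ?rmorph0 ?mulr0.
Qed.

(** The factor [g / h] trades the weight [h] of the pairing for [g]. Where
[h = 0] both sides vanish: the ratio is then 0, and so is the symbol. *)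
Lemma wproj_test_ratio f s k : wproj_w f s -> cmeasurable k ->
  L2 mu (fun x => (g x / h x)%:C%C * k x) ->
  L2 mu (W (fun x => (g x / h x)%:C%C * k x)) ->
  inner mu f (W (fun x => (g x / h x)%:C%C * k x)) =
  cintegral mu setT (fun x => s x * (k x)^*%C * (g x)%:C%C).
Proof.
move=> P mk Lk LWk; have [_ ms _ sZ _] := P; have [mk' _] := Lk.
rewrite (wproj_test P)// (inner_wcomp Tw)//.
apply: cintegral_ae.
- apply: cmeasurableM; last exact: cmeasurable_real.
  by apply: cmeasurableM => //; exact: cmeasurable_conj.
- apply: cmeasurableM; last exact: cmeasurable_real.
  by apply: cmeasurableM => //; exact: cmeasurable_conj.
- apply: filterS sZ => x sZ; have [hx|hx] := eqVneq (h x) 0.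
    by rewrite sZ// !mul0r.
  rewrite conjcZ -!mulrA; congr (_ * _).
  by rewrite mulrCA -rmorphM/= divfK// mulrC.
Qed.

Lemma wproj_test_one u s k : wproj_1 u s -> L2 mu k -> L2 mu (W1 k) ->
  inner mu u (W1 k) = cintegral mu setT (fun x => s x * (k x)^*%C * (g x)%:C%C).
Proof.
move=> P Lk LWk; have [_ ms _ _ _] := P; have [mk _] := Lk.
by rewrite (wproj_test P)// (inner_wcomp T1).
Qed.

(** Condition (c), with [E_phi(|w|^2) = (h / g) o phi] cleared of its
denominator. *)
Definition weight_is_condexp :=
  {ae mu, forall x, w x != 0 -> normc2 (w x) * g (phi x) = h (phi x)}.

(** With [k = g (s - s1)] cut to a set where everything is bounded, the tests
[(g / h) k] for [w] and [k] for 1 agree by (c); they show that [k] is orthogonal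
to itself. *)
Lemma condexp_weight_wproj_eq f s s1 : weight_is_condexp -> L2 mu f ->
  L2 mu (cweight_div w f) -> wproj_w f s -> wproj_1 (cweight_div w f) s1 ->
  ae_eq2 mu s s1.
Proof.
move=> cw Lf Lfw P P1; have [_ ms _ sZ _] := P; have [_ ms1 _ sZ1 _] := P1.
pose r x := h x + g x + g x / h x + normc2 (s x) + normc2 (s1 x).
have mr : measurable_fun setT r.
  apply: measurable_funD; last exact: measurable_normc2.
  apply: measurable_funD; last exact: measurable_normc2.
  apply: measurable_funD; last exact: mgh.
  exact: measurable_funD.
have [E [mE Eoo ndE ET En]] := le_exhaustion mu mr.
pose sg := s \- s1; have msg : cmeasurable sg by exact: cmeasurableB.
pose G n t := crestrict (E n) (fun x => (g x)%:C%C * t x).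
have mG n t : cmeasurable t -> cmeasurable (G n t).
  move=> mt; apply: cmeasurable_crestrict => //.
  by apply: cmeasurableM => //; exact: cmeasurable_real.
have n2 x := normc2_ge0 (s x); have n21 x := normc2_ge0 (s1 x).
have hn n x : E n x -> h x <= n%:R.
  move=> /En; apply: le_trans; rewrite /r.
  by have := g0 x; have := gh0 x; have := n2 x; have := n21 x; lra.
have gn n x : E n x -> g x <= n%:R.
  move=> /En; apply: le_trans; rewrite /r.
  by have := h0 x; have := gh0 x; have := n2 x; have := n21 x; lra.
have ghn n x : E n x -> g x / h x <= n%:R.
  move=> /En; apply: le_trans; rewrite /r.
  by have := h0 x; have := g0 x; have := n2 x; have := n21 x; lra.
have sn n x : E n x -> normc2 (s x) + normc2 (s1 x) <= n%:R.
  move=> /En; apply: le_trans; rewrite /r.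
  by have := h0 x; have := g0 x; have := gh0 x; lra.
have sgn n x : E n x -> normc2 (sg x) <= 2 * n%:R.
  move=> /sn; rewrite /sg /normc2 /=; case: (s x) (s1 x) => a b [e t] /= H.
  have := sqr_ge0 (a + e); have := sqr_ge0 (b + t); nra.
have GB n t C x : (E n x -> normc2 (t x) <= C) ->
    normc2 (G n t x) <= (n%:R ^+ 2 * C) * \1_(E n) x.
  rewrite /G normc2_crestrict normc2M normc2_real indicE.
  case: (boolP (x \in E n)) => [/set_mem xE /(_ xE) tC|_ _].
    rewrite mul1r mulr1 ler_pM// ?sqr_ge0 ?normc2_ge0//.
    by rewrite lerXn2r// ?nnegrE// gn.
  by rewrite mul0r mulr0.
have LG n t C : cmeasurable t -> (forall x, E n x -> normc2 (t x) <= C) ->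
    L2 mu (G n t).
  move=> mt tC; apply: (L2_bounded (mE n) (Eoo n) (mG _ _ mt)) => x.
  exact: GB (tC x).
have LGs n : L2 mu (G n s).
  by apply: (LG _ _ n%:R) => // x /sn; apply: le_trans; rewrite lerDl.
have LGs1 n : L2 mu (G n s1).
  by apply: (LG _ _ n%:R) => // x /sn; apply: le_trans; rewrite lerDr.
have K0 n : ae_eq2 mu (G n sg) (cst 0).
  pose K := G n sg; pose k := fun x => (g x / h x)%:C%C * K x.
  have mK : cmeasurable K by exact: mG.
  have mk : cmeasurable k by apply: cmeasurableM => //; exact: cmeasurable_real.
  (* On [E n], [g <= n] and [|s - s1|^2 <= 2 (|s|^2 + |s1|^2) <= 2 n]. *)
  have Cn : 0 <= n%:R ^+ 2 * (2 * n%:R) :> R.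
    by rewrite mulr_ge0 ?sqr_ge0// mulr_ge0.
  have KB x : normc2 (K x) <= (n%:R ^+ 2 * (2 * n%:R)) * \1_(E n) x.
    by apply: GB => /sgn.
  have [LK LWK] := L2_wcomp_bounded m1 T1 Cn (mE n) (Eoo n) (gn n) mK KB.
  have kB x : normc2 (k x) <=
      (n%:R ^+ 2 * (n%:R ^+ 2 * (2 * n%:R))) * \1_(E n) x.
    have := KB x; rewrite [normc2 (k x)]normc2M [normc2 (_%:C)%C]normc2_real !indicE.
    case: (boolP (x \in E n)) => [/set_mem xE|_].
      rewrite !mulr1 => Kx; rewrite ler_pM// ?sqr_ge0 ?normc2_ge0//.
      by rewrite lerXn2r// ?nnegrE// ghn.
    rewrite !mulr0 => Kx; rewrite (_ : normc2 (K x) = 0) ?mulr0//.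
    by apply/eqP; rewrite eq_le Kx normc2_ge0.
  have Ck : 0 <= n%:R ^+ 2 * (n%:R ^+ 2 * (2 * n%:R)) :> R.
    by rewrite mulr_ge0 ?sqr_ge0.
  have [Lk LWk] := L2_wcomp_bounded mw Tw Ck (mE n) (Eoo n) (hn n) mk kB.
  have tw := wproj_test_ratio P mK Lk LWk.
  have t1 := wproj_test_one P1 LK LWK.
  have same : inner mu f (W k) = inner mu (cweight_div w f) (W1 K).
    apply: inner_eq_ae; [by case: Lf|by case: LWk|by case: Lfw|by case: LWK|].
    apply: filterS2 cw ae_h_phi_neq0 => x cx hx.
    rewrite /wcomp /cweight_div /k; case: eqP => [->|/eqP wx].
      by rewrite !(mul0r, rmorph0, mulr0).
    have gh : g (phi x) / h (phi x) = (normc2 (w x))^-1.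
      have nw : normc2 (w x) != 0 by rewrite normc2_neq0.
      apply: (mulfI nw); rewrite mulrA cx// divff ?hx//.
      by rewrite mulfV.
    rewrite gh mul1r conjcM conjcZ !mulrA; congr (_ * _).
    apply: (mulIf wx); rewrite divfK//.
    transitivity (f x * ((w x * (w x)^*%C) * ((normc2 (w x))^-1)%:C%C)).
      by ring.
    by rewrite mul_conjc -rmorphM/= mulfV ?mulr1// normc2_neq0.
  have inE' t : inner mu (G n t) K =
      cintegral mu setT (fun x => t x * (K x)^*%C * (g x)%:C%C).
    rewrite /inner; congr cintegral; apply/funext => x.
    rewrite /K /G /crestrict indicE; case: (_ \in _).
      by rewrite !mul1r; ring.
    by rewrite !mul0r rmorph0 mulr0 mul0r.
  have KK : inner mu K K = 0.
    have -> : inner mu K K = inner mu (G n s \- G n s1) K.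
      apply: inner_eq_pointwise => x; congr (_ * _).
      by rewrite /K /G /crestrict /sg /=; ring.
    by rewrite innerB// !inE' -tw -t1 same subrr.
  exact: inner_eq0 LK KK.
have : {ae mu, forall x n, G n sg x = 0} by exact/ae_foralln.
move=> HG; near=> x.
have Gx : forall n, G n sg x = 0 by near: x; exact: HG.
have sx : h x = 0 -> s x = 0 by near: x; exact: sZ.
have sx1 : g x = 0 -> s1 x = 0 by near: x; exact: sZ1.
have hg : h x != 0 -> g x != 0 by near: x; exact: ae_h_neq0.
have [gx|gx] := eqVneq (g x) 0.
  rewrite sx1// sx//; apply/eqP; apply: contraTT isT => /hg.
  by rewrite gx eqxx.
have : setT x by []; rewrite -ET => -[n _ xE].
have := Gx n; rewrite /G /crestrict indicE mem_set// mul1r /sg /=.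
move/eqP; rewrite mulf_eq0 subr_eq0 => /orP[|/eqP//].
by rewrite eq_complex /= eqxx andbT (negPf gx).
Unshelve. all: by end_near. Qed.

(** Apply the hypothesis to [f = w 1_A], for [A] inside a set [B m n] where all
the functions at stake are bounded. Then [f_w = 1_A], and the tests [(g / h) 1_E]
and [1_E] give the same value, so [|w|^2 (g / h) o phi] and 1 have the same
integral over every such [A]. *)
Lemma wproj_factors_condexp :
  (forall f s, L2 mu s -> wproj_w f s ->
    L2 mu (cweight_div w f) /\ wproj_1 (cweight_div w f) s) ->
  weight_is_condexp.
Proof.
move=> H.
(* The bound on the inverse of [h] will put the symbol, cut to [E n], in [L^2]. *)
pose r x := h x + g x + g x / h x + (h x)^-1.
have mr : measurable_fun setT r.
  apply: measurable_funD; last exact: measurable_funV.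
  apply: measurable_funD; last exact: mgh.
  exact: measurable_funD.
have [E [mE Eoo ndE ET En]] := le_exhaustion mu mr.
have [F [mF Foo ndF FT Fn]] := le_exhaustion mu (measurable_normc2 mw).
have hV x : 0 <= (h x)^-1 by rewrite invr_ge0.
have hn n x : E n x -> h x <= n%:R.
  move=> /En; apply: le_trans; rewrite /r.
  by have := g0 x; have := gh0 x; have := hV x; lra.
have gn n x : E n x -> g x <= n%:R.
  move=> /En; apply: le_trans; rewrite /r.
  by have := h0 x; have := gh0 x; have := hV x; lra.
have ghn n x : E n x -> g x / h x <= n%:R.
  move=> /En; apply: le_trans; rewrite /r.
  by have := h0 x; have := g0 x; have := hV x; lra.
have hVn n x : E n x -> (h x)^-1 <= n%:R.
  move=> /En; apply: le_trans; rewrite /r.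
  by have := h0 x; have := g0 x; have := gh0 x; lra.
pose B m n := F m `&` phi @^-1` (E n) `&` [set x | w x != 0].
have mB m n : measurable (B m n).
  apply: measurableI; last exact: measurable_neq0c.
  by apply: measurableI => //; exact: mphiE.
pose q x : R[i] := (normc2 (w x) * (g (phi x) / h (phi x)))%:C%C.
have mq : cmeasurable q.
  apply: cmeasurable_real; apply: measurable_funM; first exact: measurable_normc2.
  exact: (measurableT_comp mgh mphi).
suff HB m n : {ae mu, forall x, B m n x -> q x = 1}.
  have : {ae mu, forall x m n, B m n x -> q x = 1}.
    by apply/ae_foralln => m; apply/ae_foralln => n; exact: HB.
  apply: filterS => x Hx wx.
  have : setT x by []; rewrite -FT => -[m _ Fx].
  have : setT (phi x) by []; rewrite -ET => -[n _ Ex].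
  have [] := Hx m n (conj (conj Fx Ex) wx).
  have [->|hx] := eqVneq (h (phi x)) 0.
    by rewrite invr0 !mulr0 => /esym/eqP; rewrite oner_eq0.
  by rewrite mulrA => /(congr1 (fun y => y * h (phi x))); rewrite divfK// mul1r.
pose K : X -> R[i] := crestrict (E n) (cst 1).
pose k : X -> R[i] := fun x => (g x / h x)%:C%C * K x.
have mK : cmeasurable K by exact: cmeasurable_crestrict.
have mk : cmeasurable k by apply: cmeasurableM => //; exact: cmeasurable_real.
have KB x : normc2 (K x) <= 1 * \1_(E n) x.
  by rewrite normc2_crestrict normc2_1 mulr1 mul1r.
have [LK LWK] := L2_wcomp_bounded m1 T1 ler01 (mE n) (Eoo n) (gn n) mK KB.
have kB x : normc2 (k x) <= n%:R ^+ 2 * \1_(E n) x.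
  rewrite normc2M normc2_real normc2_crestrict normc2_1 mulr1 indicE.
  case: (boolP (x \in E n)) => [/set_mem xE|_]; last by rewrite !mulr0.
  by rewrite !mulr1 lerXn2r// ?nnegrE// ghn.
have Ck : 0 <= n%:R ^+ 2 :> R by rewrite sqr_ge0.
have [Lk LWk] := L2_wcomp_bounded mw Tw Ck (mE n) (Eoo n) (hn n) mk kB.
have Lf A : measurable A -> A `<=` B m n -> L2 mu (crestrict A w).
  move=> mA AB; apply: (L2_bounded (C := m%:R) (mF m) (Foo m)).
    exact: cmeasurable_crestrict.
  move=> x; rewrite normc2_crestrict !indicE.
  case: (boolP (x \in A)) => [/set_mem/AB[[xF _] _]|_].
    by rewrite mem_set// mul1r mulr1; exact: Fn.
  by rewrite mul0r mulr_ge0.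
have qE A : measurable A -> A `<=` B m n ->
    (fun x => crestrict A w x * (W k x)^*%C) = crestrict A q.
  move=> mA AB; apply/funext => x; rewrite /crestrict indicE.
  case: (boolP (x \in A)) => [/set_mem/AB[[_ xE] _]|_]; last by rewrite !mul0r.
  rewrite !mul1r /wcomp /k /K /crestrict indicE mem_set// !mulr1.
  by rewrite conjcM conjc_real mulrA mul_conjc -rmorphM.
have oneE A : measurable A -> A `<=` B m n ->
    (fun x => cweight_div w (crestrict A w) x * (W1 K x)^*%C) =
    crestrict A (cst 1).
  move=> mA AB; apply/funext => x.
  rewrite /cweight_div /crestrict /wcomp /K /crestrict !indicE.
  case: (boolP (x \in A)) => [/set_mem/AB[[_ xE] wx]|_].
    rewrite (negPf wx) mem_set//= ?mul1r divff//.
    by apply: complex_eqP => /=; ring.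
  by rewrite !mul0r; case: ifP => _; rewrite mul0r.
have key A : measurable A -> A `<=` B m n ->
    cintegrable mu setT (crestrict A q) /\
    cintegral mu setT (crestrict A q) = cintegral mu setT (crestrict A (cst 1)).
  move=> mA AB; have LA := Lf A mA AB.
  split; first by rewrite -(qE A mA AB); exact: cintegrable_prod.
  have [t0 P0] := wproj_exists mw Tw LA.
  have [_ mt0 LWt0 tZ _] := P0.
  have P : wproj_w (crestrict A w) (crestrict (E n) t0).
    apply: wproj_crestrict => // x; rewrite /crestrict indicE.
    case: (boolP (x \in A)) => [/set_mem/AB[[_ //] _]|_].
    by rewrite mul0r eqxx.
  have Lt : L2 mu (crestrict (E n) t0).
    have mt : cmeasurable (crestrict (E n) t0) by exact: cmeasurable_crestrict.
    split => //.
    apply: (@le_lt_trans _ _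
        (n%:R%:E * \int[mu]_x (normc2 (W t0 x))%:E)%E); last first.
      by case: LWt0 => _ ?; rewrite lte_mul_pinfty// lee_fin.
    rewrite (integral_normc2_wcomp Tw)// -ge0_integralZl//; last 2 first.
    - by apply/measurable_EFinP; apply: measurable_funM => //; exact: measurable_normc2.
    - by move=> x _; rewrite lee_fin mulr_ge0// normc2_ge0.
    apply: ae_ge0_le_integral => //.
    - by move=> x _; rewrite lee_fin normc2_ge0.
    - by apply/measurable_EFinP; exact: measurable_normc2.
    - by move=> x _; rewrite -EFinM lee_fin !mulr_ge0// normc2_ge0.
    - apply: measurable_funeM; apply/measurable_EFinP.
      by apply: measurable_funM => //; exact: measurable_normc2.
    - apply: filterS tZ => x tZ _; rewrite -EFinM lee_fin normc2_crestrict indicE.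
      case: (boolP (x \in E n)) => [/set_mem xE|_]; last first.
        by rewrite mul0r !mulr_ge0// normc2_ge0.
      have [hx|hx] := eqVneq (h x) 0; first by rewrite tZ// normc2_0 !(mulr0, mul0r).
      rewrite mul1r mulrCA ler_peMr ?normc2_ge0// -ler_pdivrMr ?div1r ?hVn//.
      by rewrite lt0r hx h0.
  have [Lfw P1] := H _ _ Lt P.
  rewrite -(qE A mA AB) -(oneE A mA AB).
  by rewrite -/(inner _ _ _) (wproj_test_ratio P)// -(wproj_test_one P1).
have [iq _] := key _ (mB m n) (@subset_refl _ _).
apply: cintegral_ae_eq => //.
- have <- := oneE _ (mB m n) (@subset_refl _ _).
  have [Lfw _] : L2 mu (cweight_div w (crestrict (B m n) w)) /\ True.
    split => //; apply: (L2_bounded (C := 1) (mF m) (Foo m)).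
      by apply: cmeasurable_cweight_div => //; exact: cmeasurable_crestrict.
    move=> x; rewrite /cweight_div /crestrict !indicE mul1r.
    case: ifP => [_|/negbT wx]; first by rewrite normc2_0.
    case: (boolP (x \in B m n)) => [/set_mem[[xF _] _]|_].
      by rewrite mul1r divff// normc2_1 mem_set.
    by rewrite !mul0r normc2_0.
  exact: cintegrable_prod.
- by move=> A mA AB; have [] := key A mA AB.
Qed.

End two_weights.

(** * Multiplication operators *)

Section multiplication.
Context {d} {X : measurableType d} {R : realType}.
Variable mu : {sigma_finite_measure set X -> \bar R}.
Variables (w : X -> R[i]).
Hypothesis mw : cmeasurable w.

Lemma transfers_id : transfers mu id (fun x => normc2 (w x)) (fun x => normc2 (w x)).
Proof.
have mw2 := measurable_normc2 mw.
split; [exact: measurable_id| | |by []].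
- by split => // x; exact: normc2_ge0.
- by split => // x; exact: normc2_ge0.
Qed.

(** Multiplication by [w] is the weighted composition operator of the identity
map, whose conditional expectation is the identity. *)
Lemma reciprocal_mulopP f u : reciprocal mu (mulop mu w) (f, u) <->
  [/\ L2 mu f, L2 mu u & ae_eq2 mu u (cweight_div w f)].
Proof.
have T := transfers_id; rewrite (reciprocal_wcoP mw T).
have P0 : L2 mu f -> wproj mu id w (fun x => normc2 (w x)) f (cweight_div w f).
  move=> Lf; have mf : cmeasurable f by case: Lf.
  have mfw : cmeasurable (cweight_div w f) by exact: cmeasurable_cweight_div.
  apply: wproj_intro => //.
  - apply: (@L2_le _ _ _ mu 1 _ f) => //.
      exact: (cmeasurable_wcomp mw T mfw).
    move=> x; rewrite mul1r /wcomp /cweight_div; case: eqP => [_|/eqP wx].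
      by rewrite mulr0 normc2_0 normc2_ge0.
    by rewrite mulrC divfK.
  - apply: aeW => x /normc2_eq0 wx; by rewrite /cweight_div wx eqxx.
  - move=> k _ _; apply: inner_eq_pointwise => x; rewrite /wcomp /cweight_div.
    case: eqP => [->|/eqP wx]; first by rewrite !(mul0r, mulr0, rmorph0).
    by rewrite [w x * (f x / w x)]mulrC divfK.
have hE : {ae mu, forall x, (EFin \o (fun x => normc2 (w x))) x = (normc2 (w x))%:E}.
  exact: aeW.
split.
  move=> [Lu P]; have [Lf _ _ _ _] := P; split => //.
  apply: (condexp_inv_uniq mw T hE); first exact: (wproj_condexp_inv mw T hE P).
  exact: (wproj_condexp_inv mw T hE (P0 Lf)).
move=> [Lf Lu uf]; split => //; have [mu' _] := Lu.
apply: (wproj_ae mw T (P0 Lf) mu').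
by apply: filterS uf => x ->.
Qed.

End multiplication.

(** * The conditional expectation of the squared weight *)

Section weight_condexp.
Context {d} {X : measurableType d} {R : realType}.
Variable mu : {sigma_finite_measure set X -> \bar R}.
Variables (phi : X -> X) (w : X -> R[i]) (h g : X -> R).
Hypotheses (mw : cmeasurable w)
  (Tw : transfers mu phi (fun x => normc2 (w x)) h)
  (T1 : transfers mu phi (fun x => normc2 (cst 1 x : R[i])) g).

Let mphi : measurable_fun setT phi. Proof. by case: Tw. Qed.
Let mh : measurable_fun setT h. Proof. by case: Tw => ? ? []. Qed.
Let h0 x : 0 <= h x. Proof. by case: Tw => ? ? []. Qed.
Let mg : measurable_fun setT g. Proof. by case: T1 => ? ? []. Qed.
Let g0 x : 0 <= g x. Proof. by case: T1 => ? ? []. Qed.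
Let mphiE A : measurable A -> measurable (phi @^-1` A).
Proof. by move=> mA; rewrite -[X in measurable X]setTI; exact: mphi. Qed.

Let q x := h x / g x.
Let mq : measurable_fun setT q.
Proof. by apply: measurable_funM => //; exact: measurable_funV. Qed.
Let q0 x : 0 <= q x. Proof. by rewrite /q divr_ge0. Qed.

Lemma integral_mu_w_cst1 A (f : X -> \bar R) : measurable A ->
  measurable_fun A f -> (forall x, A x -> 0 <= f x)%E ->
  (\int[mu_w mu (cst 1%R)]_(x in A) f x = \int[mu]_(x in A) f x)%E.
Proof.
move=> mA mf f0.
rewrite (@ge0_integral_density _ _ _ mu (fun x => normc2 (cst 1 x : R[i])))//.
- by apply: eq_integral => x _; rewrite /= normc2_1 mule1.
- by apply: measurable_normc2; exact: cmeasurable_cst.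
- by move=> x; exact: normc2_ge0.
Qed.

(** [(h / g) o phi] is [E_phi(|w|^2)]: by transfer its integral over the preimage
of [D] is that of [(h / g) g] over [D], and [h] vanishes where [g] does. *)
Lemma integral_ratio_phi D : measurable D ->
  (\int[mu]_(x in phi @^-1` D) (q (phi x))%:E =
   \int[mu]_(x in phi @^-1` D) (normc2 (w x))%:E)%E.
Proof.
move=> mD; have [_ _ _ ->//] := Tw.
rewrite [LHS]integral_mkcond [RHS]integral_mkcond.
transitivity (\int[mu]_x ((\1_D (phi x) * q (phi x)) * normc2 (cst 1 x : R[i]))%:E)%E.
  apply: eq_integral => x _; rewrite patchE normc2_1 mulr1 indicE.
  rewrite (_ : (x \in phi @^-1` D) = (phi x \in D))//.
  by case: (_ \in D); rewrite ?mul1r ?mul0r.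
have m1q : measurable_fun setT (fun x => \1_D x * q x).
  by apply: measurable_funM => //; exact: measurable_indic.
rewrite (integral_transfer T1 (g := fun x => \1_D x * q x))//.
apply: ae_eq_integral => //.
- by apply/measurable_EFinP; exact: measurable_funM.
- apply/measurable_restrict => //; rewrite setTI.
  by apply/measurable_EFinP; exact: measurable_funTS.
apply: filterS (ae_h_neq0 Tw T1) => x hg _ /=.
rewrite patchE indicE; case: (_ \in D); last by rewrite !mul0r.
rewrite mul1r /q; congr EFin.
have [gx|gx] := eqVneq (g x) 0; last by rewrite divfK.
rewrite gx mulr0; apply/esym/eqP; apply: contraTT isT => /hg.
by rewrite gx eqxx.
Qed.

Lemma ge0_integral_eq_lt A (e f : X -> \bar R) : measurable A ->
  measurable_fun A e -> measurable_fun A f ->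
  (forall x, A x -> 0 <= e x)%E -> (forall x, A x -> 0 <= f x)%E ->
  (forall x, A x -> e x < f x)%E ->
  (\int[mu]_(x in A) e x = \int[mu]_(x in A) f x)%E ->
  (\int[mu]_(x in A) f x < +oo)%E -> {ae mu, forall x, ~ A x}.
Proof.
move=> mA me mf e0 f0 ef E foo.
have inf : mu.-integrable A f.
  apply/integrableP; split => //; apply: le_lt_trans foo.
  rewrite le_eqVlt; apply/orP; left; apply/eqP; apply: eq_integral => x.
  by rewrite inE => /f0 fx; rewrite gee0_abs.
have ine : mu.-integrable A e.
  apply/integrableP; split => //; rewrite -E in foo; apply: le_lt_trans foo.
  rewrite le_eqVlt; apply/orP; left; apply/eqP; apply: eq_integral => x.
  by rewrite inE => /e0 ex; rewrite gee0_abs.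
have : (\int[mu]_(x in A) `|(f \- e) x| = 0)%E.
  transitivity (\int[mu]_(x in A) (f \- e) x)%E.
    apply: eq_integral => x; rewrite inE => Ax.
    by rewrite gee0_abs// ltW// sube_gt0 ef.
  rewrite integralB// E subee//; exact: integrable_fin_num.
move/ae_eq_integral_abs => -[//||N [mN N0 NP]].
  exact: emeasurable_funB.
exists N; split => // x /= /contrapT Ax; apply: NP => /= /(_ Ax) H.
by have := ef x Ax; rewrite -sube_gt0 H ltxx.
Qed.

Lemma condexp_weight_exists : weight_is_condexp mu phi w h g ->
  exists2 e : X -> \bar R,
    is_condexp_ge0 mu phi (cst 1) (fun x => (normc2 (w x))%:E) e &
    {ae mu, forall x, w x != 0 -> (normc2 (w x))%:E = e x}.
Proof.
move=> cw; exists (fun x => (q (phi x))%:E).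
  split.
  - apply/measurable_EFinP.
    exact: (measurableT_comp mq (measurable_preimage_map (phi := phi))). 
  - by move=> x; rewrite lee_fin.
  - move=> D mD; have mpD := mphiE mD.
    rewrite !integral_mu_w_cst1//.
    + exact: integral_ratio_phi.
    + by apply/measurable_EFinP; apply: measurable_funTS; exact: measurable_normc2.
    + by move=> x _; rewrite lee_fin normc2_ge0.
    + apply/measurable_EFinP; apply: measurable_funTS.
      exact: (measurableT_comp mq mphi).
    + by move=> x _; rewrite lee_fin.
apply: filterS2 cw (ae_g_phi_neq0 T1) => x cx gx wx.
by rewrite /q -cx// mulfK.
Qed.

(** Any version [e] of [E_phi(|w|^2)] equals [(h / g) o phi]: the sets where one
is smaller than the other are preimages of measurable sets, and on those the
two have the same integral. *)
Lemma condexp_weight_inv (e : X -> \bar R) :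
  is_condexp_ge0 mu phi (cst 1) (fun x => (normc2 (w x))%:E) e ->
  {ae mu, forall x, w x != 0 -> (normc2 (w x))%:E = e x} ->
  weight_is_condexp mu phi w h g.
Proof.
move=> [me e0 eE] we.
have me' : measurable_fun setT e.
  move=> _ A mA; have [B mB] := me measurableT A mA.
  by rewrite setTI => <-; exact: mphiE.
have mqp : measurable_fun setT (fun x => (q (phi x))%:E).
  by apply/measurable_EFinP; exact: (measurableT_comp mq mphi).
have mqp' : measurable_fun (setT : set (g_sigma_algebra_preimageType phi))
    (fun x => (q (phi x))%:E).
  apply/measurable_EFinP.
  exact: (measurableT_comp mq (measurable_preimage_map (phi := phi))).
have qp0 x : (0 <= (q (phi x))%:E)%E by rewrite lee_fin.
have [E [mE Eoo ndE ET En]] := le_exhaustion mu mh.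
have inv (A : set X) n :
    measurable (A : set (g_sigma_algebra_preimageType phi)) ->
    [/\ measurable (A `&` phi @^-1` (E n)),
      (\int[mu]_(x in A `&` phi @^-1` (E n)) e x =
       \int[mu]_(x in A `&` phi @^-1` (E n)) (q (phi x))%:E)%E &
      (\int[mu]_(x in A `&` phi @^-1` (E n)) (q (phi x))%:E < +oo)%E].
  move=> [B mB]; rewrite setTI => <-; rewrite -preimage_setI.
  have mBE : measurable (B `&` E n) by exact: measurableI.
  have mpBE := mphiE mBE.
  split => //.
    rewrite integral_ratio_phi//; have := eE _ mBE.
    rewrite !integral_mu_w_cst1//.
    - by apply/measurable_EFinP; apply: measurable_funTS; exact: measurable_normc2.
    - by move=> x _; rewrite lee_fin normc2_ge0.
    - exact: measurable_funTS.
  rewrite integral_ratio_phi//; have [_ _ _ ->//] := Tw.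
  apply: (@le_lt_trans _ _ (\int[mu]_(x in E n) (n%:R)%:E)%E).
    apply: (@le_trans _ _ (\int[mu]_(x in E n) (h x)%:E)%E).
      apply: ge0_subset_integral => //.
      - by apply/measurable_EFinP; exact: measurable_funTS.
      - by move=> x _; rewrite lee_fin.
    apply: ge0_le_integral => //.
    - by move=> x _; rewrite lee_fin.
    - by apply/measurable_EFinP; exact: measurable_funTS.
    - by move=> x /En; rewrite lee_fin.
  by rewrite integral_cst// lte_mul_pinfty// ?lee_fin//; exact: Eoo.
(* Both functions are measurable for the preimage sigma-algebra, so the sets
   that compare them are preimages and [inv] applies. *)
have lt1 : {ae mu, forall x, ~ (e x < (q (phi x))%:E)%E}.
  have : {ae mu, forall x n,
      ~ ([set x | (e x < (q (phi x))%:E)%E] `&` phi @^-1` (E n)) x}.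
    apply/ae_foralln => n.
    have [|mA eA foo] := inv [set x | (e x < (q (phi x))%:E)%E] n.
      by have := measurable_lte measurableT me mqp'; rewrite setTI.
    apply: (ge0_integral_eq_lt mA _ _ _ _ _ eA foo).
    - exact: measurable_funTS.
    - exact: measurable_funTS.
    - by move=> x _.
    - by move=> x _.
    - by move=> x [].
  apply: filterS => x Hx exq.
  by have : setT (phi x) by []; rewrite -ET => -[n _ Ex]; exact: (Hx n).
have lt2 : {ae mu, forall x, ~ ((q (phi x))%:E < e x)%E}.
  have : {ae mu, forall x n,
      ~ ([set x | ((q (phi x))%:E < e x)%E] `&` phi @^-1` (E n)) x}.
    apply/ae_foralln => n.
    have [|mA eA foo] := inv [set x | ((q (phi x))%:E < e x)%E] n.
      by have := measurable_lte measurableT mqp' me; rewrite setTI.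
    rewrite -eA in foo.
    apply: (ge0_integral_eq_lt mA _ _ _ _ _ (esym eA) foo).
    - exact: measurable_funTS.
    - exact: measurable_funTS.
    - by move=> x _.
    - by move=> x _.
    - by move=> x [].
  apply: filterS => x Hx exq.
  by have : setT (phi x) by []; rewrite -ET => -[n _ Ex]; exact: (Hx n).
near=> x => wx.
have wex : w x != 0 -> (normc2 (w x))%:E = e x by near: x; exact: we.
have l1 : ~ (e x < (q (phi x))%:E)%E by near: x; exact: lt1.
have l2 : ~ ((q (phi x))%:E < e x)%E by near: x; exact: lt2.
have gx : g (phi x) != 0 by near: x; exact: (ae_g_phi_neq0 T1).
have ex : e x = (q (phi x))%:E.
  by case: (ltgtP (e x) (q (phi x))%:E).
by move: (wex wx); rewrite ex => -[->]; rewrite /q divfK.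
Unshelve. all: by end_near. Qed.

End weight_condexp.

(** * The space of square-integrable functions for [1 + |w|^-2] *)

Section weighted_L2.
Context {d} {X : measurableType d} {R : realType}.
Variable mu : {sigma_finite_measure set X -> \bar R}.
Variables (w : X -> R[i]).
Hypothesis mw : cmeasurable w.
Implicit Types f : X -> R[i].

Let u x : \bar R := (1 + (normc2 (w x))%:E^-1)%E.
Let v x : R := 1 + (normc2 (w x))^-1.

Let mw2 : measurable_fun setT (fun x => normc2 (w x)).
Proof. exact: measurable_normc2. Qed.

Let uE x : w x != 0 -> u x = (v x)%:E.
Proof. by move=> wx; rewrite /u inver ifN// normc2_neq0. Qed.

Let u_oo x : w x = 0 -> u x = +oo%E.
Proof. by move=> wx; rewrite /u wx normc2_0 inve0. Qed.

Let mv : measurable_fun setT v.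
Proof.
apply: measurable_funD => //; apply: measurable_funV => // x.
exact: normc2_ge0.
Qed.

Let v0 x : 0 <= v x.
Proof. by rewrite addr_ge0// invr_ge0 normc2_ge0. Qed.

Let mu_ : measurable_fun setT u.
Proof.
rewrite (_ : u = fun x => if w x != 0 then (v x)%:E else +oo%E).
  apply: measurable_fun_ifT => //.
    apply: (measurable_fun_bool true); rewrite setTI.
    have := measurable_neq0c mw; congr measurable.
  exact/measurable_EFinP.
apply/funext => x; have [wx|wx] := eqVneq (w x) 0; first exact: u_oo.
exact: uE.
Qed.

Let u0 x : (0 <= u x)%E.
Proof.
have [wx|wx] := eqVneq (w x) 0; first by rewrite u_oo.
by rewrite uE// lee_fin.
Qed.

Let vu x : ((v x)%:E <= u x)%E.
Proof.
have [wx|wx] := eqVneq (w x) 0; first by rewrite u_oo// leey.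
by rewrite uE.
Qed.

Let normc2_cweight f x : normc2 (cweight_div w f x) = normc2 (f x) * (normc2 (w x))^-1.
Proof.
rewrite /cweight_div; case: eqP => [->|/eqP wx].
  by rewrite normc2_0 invr0 mulr0.
have nw : normc2 (w x) != 0 by rewrite normc2_neq0.
by apply: (mulIf nw); rewrite -normc2M divfK// mulfVK.
Qed.

Lemma L2_density f : L2 (density mu u) f ->
  L2 mu f /\ L2 mu (cweight_div w f).
Proof.
move=> [mf foo].
have mf2 : measurable_fun setT (fun x => (normc2 (f x))%:E).
  by apply/measurable_EFinP; exact: measurable_normc2.
have mev : measurable_fun setT (EFin \o v) by exact/measurable_EFinP.
have ev0 x : (0 <= (EFin \o v) x)%E by rewrite lee_fin.
have fv : (\int[mu]_x (normc2 (f x) * v x)%:E < +oo)%E.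
  apply: le_lt_trans foo.
  under eq_integral do rewrite EFinM.
  rewrite -(ge0_integral_density mu mv v0)//; last first.
    by move=> x _; rewrite lee_fin normc2_ge0.
  apply: (@ge0_le_measure_integral _ _ _ (density_measure mu mev ev0)
    (density_measure mu mu_ u0)) => //.
    move=> S mS; apply: ge0_le_integral => //.
    - exact: measurable_funTS.
    - exact: measurable_funTS.
    - by move=> x _; exact: vu.
  by move=> x; rewrite lee_fin normc2_ge0.
have mfw : cmeasurable (cweight_div w f) by exact: cmeasurable_cweight_div.
split; split => //; apply: le_lt_trans fv; apply: ge0_le_integral => //.
- by move=> x _; rewrite lee_fin normc2_ge0.
- apply/measurable_EFinP; apply: measurable_funM => //; exact: measurable_normc2.
- move=> x _; rewrite lee_fin ler_peMr ?normc2_ge0// lerDl invr_ge0.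
  exact: normc2_ge0.
- by move=> x _; rewrite lee_fin normc2_ge0.
- by apply/measurable_EFinP; exact: measurable_normc2.
- apply/measurable_EFinP; apply: measurable_funM => //; exact: measurable_normc2.
- move=> x _; rewrite lee_fin normc2_cweight ler_wpM2l ?normc2_ge0//.
  by rewrite lerDr.
Qed.

(** The density is infinite on [{w = 0}], so [f] has to be cut to
[{w != 0}]. *)
Lemma L2_density_restrict f : L2 mu f -> L2 mu (cweight_div w f) ->
  L2 (density mu u) (crestrict [set x | w x != 0] f).
Proof.
move=> Lf Lfw; have mf : cmeasurable f by case: Lf.
pose A := [set x | w x != 0]; have mA : measurable A by exact: measurable_neq0c.
have mfA : cmeasurable (crestrict A f) by exact: cmeasurable_crestrict.
have mf2 : measurable_fun setT (fun x => (normc2 (crestrict A f x))%:E).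
  by apply/measurable_EFinP; exact: measurable_normc2.
have mev : measurable_fun setT (EFin \o v) by exact/measurable_EFinP.
have ev0 x : (0 <= (EFin \o v) x)%E by rewrite lee_fin.
split => //.
have -> : (\int[density mu u]_x (normc2 (crestrict A f x))%:E =
    \int[density mu (EFin \o v)]_(x in A) (normc2 (crestrict A f x))%:E)%E.
  transitivity (\int[density mu u]_(x in A) (normc2 (crestrict A f x))%:E)%E.
    pose nu : {measure set X -> \bar R} := density_measure mu mu_ u0.
    rewrite -[LHS]/(\int[nu]_x (normc2 (crestrict A f x))%:E)%E.
    rewrite -[RHS]/(\int[nu]_(x in A) (normc2 (crestrict A f x))%:E)%E.
    rewrite [RHS]integral_mkcond; apply: eq_integral => x _.
    rewrite patchE; case: ifPn => // xA.
    by rewrite /crestrict indicE (negPf xA) mul0r normc2_0.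
  apply: (@eq_measure_integral _ _ _ A (density_measure mu mev ev0)
    (density_measure mu mu_ u0)) => B mB BA.
  by apply: eq_integral => x; rewrite inE => /BA wx; exact: uE.
rewrite ge0_integral_density//; last 2 first.
- exact: measurable_funTS.
- by move=> x _; rewrite lee_fin normc2_ge0.
apply: (@le_lt_trans _ _ (\int[mu]_x
    ((normc2 (f x))%:E + (normc2 (cweight_div w f x))%:E))%E).
  rewrite integral_mkcond; apply: ge0_le_integral => //.
  - by move=> x _; apply: erestrict_ge0 => y _; rewrite -EFinM lee_fin mulr_ge0// normc2_ge0.
  - apply/(measurable_restrictT _ mA).
    by apply: emeasurable_funM; exact: measurable_funTS.
  - apply: emeasurable_funD; apply/measurable_EFinP.
      exact: measurable_normc2.
    by apply: measurable_normc2; case: Lfw.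
  - move=> x _; rewrite patchE; case: ifPn => [|_].
      rewrite -EFinM -EFinD lee_fin normc2_crestrict normc2_cweight indicE => ->.
      by rewrite mul1r /v mulrDr mulr1.
    by rewrite -EFinD lee_fin addr_ge0// normc2_ge0.
rewrite ge0_integralD//.
- by rewrite lte_add_pinfty//; [case: Lf|case: Lfw].
- by move=> x _; rewrite lee_fin normc2_ge0.
- by apply/measurable_EFinP; exact: measurable_normc2.
- by move=> x _; rewrite lee_fin normc2_ge0.
- by apply/measurable_EFinP; apply: measurable_normc2; case: Lfw.
Qed.

End weighted_L2.

Theorem theorem20 (R : realType) (d : measure_display) (X : measurableType d)
    (mu : {sigma_finite_measure set X -> \bar R})
    (phi : X -> X) (w : X -> R[i])
    (mphi : measurable_fun setT phi) (mw : cmeasurable w)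
    (dw : wco_densely_defined mu phi w)
    (d1 : wco_densely_defined mu phi (cst 1))
    (hw h1 : X -> \bar R)
    (hwE : is_RN mu phi w hw) (h1E : is_RN mu phi (cst 1) h1) :
  let Cw := wco mu phi w in
  let C1 := wco mu phi (cst 1) in
  let Mw := mulop mu w in
  let condexp_inv_agree (f : X -> R[i]) := exists gw g1,
    [/\ is_condexp_inv mu phi w hw f gw,
        is_condexp_inv mu phi (cst 1) h1 f g1 & ae_eq2 mu gw g1] in
  let a1 := reciprocal mu Cw =
    opcomp (reciprocal mu C1) (reciprocal mu Mw) in
  let a2 := reciprocal mu Cw `<=`
    opcomp (reciprocal mu C1) (reciprocal mu Mw) in
  let a3 := opcomp (reciprocal mu C1) (reciprocal mu Mw) `<=`
    reciprocal mu Cw in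
  let b1 := forall f, dom (reciprocal mu Cw) f ->
    L2 mu (cweight_div w f) /\ condexp_inv_agree (cweight_div w f) in
  let b2 := forall f,
    L2 (density mu (fun x => 1 + (normc2 (w x))%:E^-1)%E) f ->
    condexp_inv_agree (cweight_div w f) in
  let c := exists2 e : X -> \bar R,
    is_condexp_ge0 mu phi (cst 1) (fun x => (normc2 (w x))%:E) e &
    {ae mu, forall x, w x != 0 -> (normc2 (w x))%:E = e x} in
  (a1 <-> a2) /\ (a2 <-> b1) /\ (b1 -> c) /\ (c -> b2) /\ (b2 -> a3).
Proof.
move=> Cw C1 Mw agree a1 a2 a3 b1 b2 c.
have m1 : cmeasurable (cst 1 : X -> R[i]) by exact: cmeasurable_cst.
have [h Tw hE] := RN_transfers mphi mw (proj2 dw) hwE.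
have [g T1 gE] := RN_transfers mphi m1 (proj2 d1) h1E.
have div1 (f : X -> R[i]) : cweight_div (cst 1) f = f.
  by apply/funext => x; rewrite /cweight_div /= oner_eq0 divr1.
have CwP f s : reciprocal mu Cw (f, s) <-> L2 mu s /\ wproj mu phi w h f s.
  exact: reciprocal_wcoP.
have factorP f s : opcomp (reciprocal mu C1) (reciprocal mu Mw) (f, s) <->
    [/\ L2 mu f, L2 mu (cweight_div w f), L2 mu s &
      wproj mu phi (cst 1) g (cweight_div w f) s].
  split.
    move=> [u /= /(reciprocal_mulopP _ mw)[Lf Lu uf] /(reciprocal_wcoP m1 T1)[Ls P]].
    have Lfw : L2 mu (cweight_div w f).
      by apply: (L2_ae Lu) => //; apply: cmeasurable_cweight_div => //; case: Lf.
    split => //; exact: wproj_left_ae P Lfw uf.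
  move=> [Lf Lfw Ls P]; exists (cweight_div w f) => /=.
    by apply/(reciprocal_mulopP _ mw); split => //; exact: aeW.
  by apply/(reciprocal_wcoP m1 T1).
have condexp1 f s : wproj mu phi (cst 1) g f s ->
    is_condexp_inv mu phi (cst 1) h1 f s.
  by move=> P; rewrite -[f]div1; exact: (wproj_condexp_inv m1 T1 gE P).
have condexp1_inv f s : L2 mu f -> is_condexp_inv mu phi (cst 1) h1 f s ->
    wproj mu phi (cst 1) g f s.
  by move=> Lf; rewrite -{1}[f]div1; exact: (condexp_inv_wproj m1 T1 gE Lf).
have ba : b1 -> a2.
  move=> H [f s] /[dup] Cfs /CwP[Ls P]; apply/factorP.
  have [Lf ms _ _ _] := P.
  have [|Lfw [gw [g1 [Ew E1 wg]]]] := H f; first by exists s.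
  split => //; have P1 := condexp1_inv _ _ Lfw E1.
  apply: (wproj_ae m1 T1 P1 ms).
  have sg := condexp_inv_uniq mw Tw hE (wproj_condexp_inv mw Tw hE P) Ew.
  by apply: filterS2 sg wg => x -> ->.
have ab : a2 -> b1.
  move=> H f [s Cfs]; have [Ls P] := (CwP _ _).1 Cfs.
  have [Lf Lfw _ P1] := (factorP _ _).1 (H _ Cfs).
  split => //; exists s, s; split; last exact: aeW.
  - exact: (wproj_condexp_inv mw Tw hE P).
  - exact: condexp1.
have bc : b1 -> c.
  move=> H; apply: (condexp_weight_exists mw Tw T1).
  apply: (wproj_factors_condexp mw Tw T1) => f s Ls P.
  have Cfs : reciprocal mu Cw (f, s) by apply/CwP.
  by have [_ Lfw _ P1] := (factorP _ _).1 (ba H _ Cfs).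
have cb : c -> b2.
  move=> [e eE we] f Lfd; have [Lf Lfw] := L2_density mw Lfd.
  have cw := condexp_weight_inv mw Tw T1 eE we.
  have [s P] := wproj_exists mw Tw Lf.
  have [s1 P1] := wproj_exists m1 T1 Lfw.
  exists s, s1; split.
  - exact: (wproj_condexp_inv mw Tw hE P).
  - exact: condexp1.
  - exact: (condexp_weight_wproj_eq mw Tw T1 cw Lf Lfw P P1).
have ba3 : b2 -> a3.
  move=> H [f s] /factorP[Lf Lfw Ls P1]; apply/CwP; split => //.
  have := H _ (L2_density_restrict mw Lf Lfw).
  rewrite (_ : cweight_div w (crestrict _ f) = cweight_div w f); last first.
    apply/funext => x; rewrite /cweight_div /crestrict indicE.
    case: eqP => // /eqP wx; rewrite mem_set//; by rewrite mul1r.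
  move=> [gw [g1 [Ew E1 wg]]].
  have ms : cmeasurable s by case: Ls.
  apply: (wproj_ae mw Tw (condexp_inv_wproj mw Tw hE Lf Ew) ms).
  have sg := condexp_inv_uniq m1 T1 gE (condexp1 _ _ P1) E1.
  by apply: filterS2 sg wg => x -> ->.
split; last by split.
split; first by move=> E; rewrite /a2 -E.
move=> H; apply/seteqP; split => //.
exact/ba3/cb/bc/ab.
Qed.
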